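(* Let $\Omega\subset\mathbb R^n$ be open, let $X(\Omega)$ be a Banach function space, and let $V$ be a Banach space. 1) If $u\in W^1X(\Omega;V)$, then $u\in R^1X(\Omega;V)$. Moreover, $|\nabla u|$ is a Reshetnyak upper gradient of $u$ and $\|u\|_{R^1X}\le\|u\|_{W^1X}$. 2) If $V$ has the Radon-Nikodým property and $u\in R^1X(\Omega;V)$, then $u\in W^1X(\Omega;V)$ and $\|u\|_{W^1X}\le\sqrt n\,\|u\|_{R^1X}$.
   Context: Banach spaces are real; $|A|$ is Lebesgue measure. $M(\Omega)$ is the set of real-valued measurable functions on $\Omega$ (identified when equal a.e.). A Banach space $X(\Omega)\subset M(\Omega)$ with norm $\|\cdot\|_X$ (put $\|f\|_X=\infty$ if $f\notin X(\Omega)$) is a Banach function space if: (P1) $|f|\le g$, $f\in M(\Omega)$, $g\in X(\Omega)$ imply $f\in X(\Omega)$ and $\|f\|_X\le\|g\|_X$; (P2) $0\le f_n\nearrow f$ a.e. implies $\|f_n\|_X\nearrow\|f\|_X$; (P3) $\chi_A\in X(\Omega)$ for every measurable $A\subset\Omega$ with $|A|<\infty$; (P4) for every measurable $A\subset\Omega$ with $|A|<\infty$ there is $C_A>0$ with $\int_A|f|\,dx\le C_A\|f\chi_A\|_X$ for all $f\in X(\Omega)$. $X(\Omega;V)$ is the space of strongly measurable $u:\Omega\to V$ with $\|u(\cdot)\|_V\in X(\Omega)$, with norm $\|u\|_{X(\Omega;V)}=\big\|\|u(\cdot)\|_V\big\|_X$. A function $w\in L^1_{loc}(\Omega;V)$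 is the weak partial derivative $\partial_j u$ of $u\in L^1_{loc}(\Omega;V)$ if $\int_\Omega \frac{\partial\varphi}{\partial x_j}u\,dx=-\int_\Omega\varphi w\,dx$ (Bochner integrals) for all $\varphi\in C_0^\infty(\Omega)$. $W^1X(\Omega;V)$ is the space of $u\in X(\Omega;V)$ whose weak partial derivatives exist and belong to $X(\Omega;V)$, with norm $\|u\|_{W^1X}=\|u\|_{X(\Omega;V)}+\||\nabla u|\|_X$, where $|\nabla u|=\big(\sum_{j=1}^n\|\partial_ju\|_V^2\big)^{1/2}$; $W^1X(\Omega)=W^1X(\Omega;\mathbb R)$. $R^1X(\Omega;V)$ (Reshetnyak--Sobolev space) is the class of $u\in X(\Omega;V)$ such that: (A) $\langle v^*,u\rangle\in W^1X(\Omega)$ for every $v^*\in V^*$ with $\|v^*\|\le1$; (B) there is a non-negative $g\in X(\Omega)$ such that for every $v^*\in V^*$ with $\|v^*\|\le 1$, $|\nabla\langle v^*,u\rangle|\le g$ a.e. on $\Omega$. Such a $g$ is called a Reshetnyak upper gradient of $u$. The norm is $\|u\|_{R^1X}=\|u\|_{X(\Omega;V)}+\inf\|g\|_X$, the infimum over all Reshetnyak upper gradients $g$ of $u$. $V$ has the Radon-Nikodým property if for every $\sigma$-finite complete measure space $(S,\Sigma,\mu)$ and every $V$-valued measure $\nu$ on $\Sigma$ of bounded variation that is absolutely continuous with respect to $\mu$ there is $f\in L^1(S;V)$ with $\nu(A)=\int_Af\,d\mu$ for all $A\in\Sigma$. Equivalently, every locally absolutely continuous (or every locally Lipschitz) function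 $\mathbb R\to V$ is differentiable a.e. *)

(* Defs.v *)
From HB Require Import structures.
From mathcomp Require Import all_boot all_order all_algebra.
From mathcomp Require Import all_classical all_reals all_analysis.

Set Implicit Arguments.
Unset Strict Implicit.
Unset Printing Implicit Defensive.

Import Order.TTheory GRing.Theory Num.Theory.
Import numFieldNormedType.Exports.

Local Open Scope classical_set_scope.
Local Open Scope ring_scope.

(* R^n is 'rV[R]_n.+1, so that the dimension is always positive. *)

Section lebesgue_rV.
Context {R : realType} {n : nat}.
Local Notation T := 'rV[R]_n.+1.

(* A box is encoded by its pair (lower corner, upper corner). *)
Definition box (ab : T * T) : set T :=
  [set x | forall i, ab.1 ord0 i <= x ord0 i <= ab.2 ord0 i].

Definition box_volume (ab : T * T) : R :=
  \prod_(i < n.+1) (ab.2 ord0 i - ab.1 ord0 i).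

Definition box_cover (A : set T) : set ((T * T)^nat) :=
  [set F : (T * T)^nat | (forall k i, (F k).1 ord0 i <= (F k).2 ord0 i) /\
           A `<=` \bigcup_k box (F k)].

Definition lebesgue_outer_rV (A : set T) : \bar R :=
  ereal_inf [set (\sum_(k <oo) (box_volume (F k))%:E)%E | F in box_cover A].

Lemma box_volume_ge0 (A : set T) F k :
  box_cover A F -> 0 <= box_volume (F k).
Proof. by case=> le12 _; apply: prodr_ge0 => i _; rewrite subr_ge0. Qed.

Lemma lebesgue_outer_rV_ge0 A : (0 <= lebesgue_outer_rV A)%E.
Proof.
apply: le_ereal_inf_tmp => _ [F cF <-]; apply: nneseries_ge0 => k _ _.
by rewrite lee_fin (box_volume_ge0 _ cF).
Qed.

Lemma lebesgue_outer_rV0 : lebesgue_outer_rV set0 = 0%E.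
Proof.
apply/eqP; rewrite eq_le lebesgue_outer_rV_ge0 andbT.
apply: ereal_inf_lbound; exists (fun=> (0, 0)); first by split.
apply: eseries0 => k _ _.
by rewrite /box_volume big_ord_recl /= mxE subrr mul0r.
Qed.

Lemma le_lebesgue_outer_rV :
  {homo lebesgue_outer_rV : A B / A `<=` B >-> (A <= B)%E}.
Proof.
move=> A B AB; apply: ereal_inf_le_tmp => _ [F [leF BF] <-].
by exists F => //; split => //; exact: subset_trans BF.
Qed.

Lemma lebesgue_outer_rV_sigma_subadditive :
  sigma_subadditive lebesgue_outer_rV.
Proof.
move=> A.
have [[i ioo]|] := pselect (exists i, lebesgue_outer_rV (A i) = +oo%E).
  rewrite (eseries_pinfty _ _ ioo) ?leey// => k _.
  by rewrite -ltNye (lt_le_trans _ (lebesgue_outer_rV_ge0 _)).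
rewrite -forallNE => Aoo; apply/lee_addgt0Pr => e e0.
rewrite (le_trans _ (epsilon_trick _ _ (ltW e0)))//; last first.
  by move=> k; exact: lebesgue_outer_rV_ge0.
have [G PG] : {G : nat -> (T * T)^nat & forall k, box_cover (A k) (G k) /\
    (\sum_(j <oo) (box_volume (G k j))%:E <=
       lebesgue_outer_rV (A k) + (e / (2 ^ k.+1)%:R)%:E)%E}.
  apply: (@choice _ _ (fun k (B : (T * T)^nat) => box_cover (A k) B /\
    (\sum_(j <oo) (box_volume (B j))%:E <=
       lebesgue_outer_rV (A k) + (e / (2 ^ k.+1)%:R)%:E)%E)) => k.
  have fA : lebesgue_outer_rV (A k) \is a fin_num.
    rewrite ge0_fin_numE ?lebesgue_outer_rV_ge0// ltey.
    exact/eqP/Aoo.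
  have ek : 0 < e / (2 ^ k.+1)%:R by rewrite divr_gt0// ltr0n expn_gt0.
  have [_ [B cB <-] /ltW leB] := lb_ereal_inf_adherent ek fA.
  by exists B.
pose v (p : nat * nat) := (box_volume (G p.1 p.2))%:E.
have v0 p : (0 <= v p)%E by rewrite lee_fin (box_volume_ge0 _ (PG p.1).1).
apply: (@le_trans _ _ (\esum_(p in setT) v p)).
  have /card_esym/ppcard_eqP[f] := card_nat2.
  apply: ereal_inf_lbound; exists (fun k => G (f k).1 (f k).2).
    split=> [k i|t [k _ Akt]]; first exact: ((PG _).1.1).
    have [j _ Gkj] := (PG k).1.2 _ Akt.
    by exists (f^-1%FUN (k, j)) => //=; rewrite invK ?inE.
  by rewrite -(esum_pred_image v f xpredT) ?[fun=> _]set_true// image_eq.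
rewrite (_ : [set: nat * nat] = [set: nat] `*`` (fun=> [set: nat])); last first.
  by apply/seteqP; split.
rewrite -(@esum_esum _ _ _ _ _ (fun i j => v (i, j)))//.
rewrite -(nneseries_esumT (a := fun i => \esum_(j in setT) v (i, j))%E);
  last by move=> k; exact: esum_ge0.
apply: lee_nneseries => [k _ _|k _]; first exact: esum_ge0.
rewrite -(nneseries_esumT (a := fun j => v (k, j)))//.
exact: (PG k).2.
Qed.

HB.instance Definition _ := isOuterMeasure.Build R T lebesgue_outer_rV
  lebesgue_outer_rV0 lebesgue_outer_rV_ge0 le_lebesgue_outer_rV
  lebesgue_outer_rV_sigma_subadditive.

(* The canonical sigma-algebra on R^n is that of the Lebesgue (i.e.,
   Caratheodory) measurable sets, hence complete, and not the Borel one. *)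
HB.instance Definition _ :=
  Measurable.copy T (caratheodory_type lebesgue_outer_rV).

Definition lebesgue_rV : set T -> \bar R := lebesgue_outer_rV.

HB.instance Definition _ := isMeasure.Build _ T R lebesgue_rV
  (@caratheodory_measure0 R T lebesgue_outer_rV)
  (@caratheodory_measure_ge0 R T lebesgue_outer_rV)
  (@caratheodory_measure_sigma_additive R T lebesgue_outer_rV).

End lebesgue_rV.

Section bochner.
Context d (S : measurableType d) (R : realType).
Context (mu : {measure set S -> \bar R}) (V : completeNormedModType R).
Implicit Types (D : set S) (u s : S -> V).

Definition simple_on D s :=
  finite_set (s @` D) /\ forall v, measurable (D `&` s @^-1` [set v]).

Definition integrable_simple_on D s :=
  simple_on D s /\ forall v, v != 0 -> (mu (D `&` s @^-1` [set v]) < +oo)%E.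

(* [fine] sends an infinite measure to 0; this may only happen for v = 0. *)
Definition simple_integral D s : V :=
  \sum_(v \in s @` D) fine (mu (D `&` s @^-1` [set v])) *: v.

Definition strongly_measurable D u :=
  exists s : nat -> S -> V, (forall k, simple_on D (s k)) /\
    \forall x \ae mu, D x -> s k x @[k --> \oo] --> u x.

Definition is_bochner_integral D u (w : V) :=
  strongly_measurable D u /\
  exists s : nat -> S -> V,
    [/\ forall k, integrable_simple_on D (s k),
        (\int[mu]_(x in D) `|u x - s k x|%:E)%E @[k --> \oo] --> 0%E &
        simple_integral D (s k) @[k --> \oo] --> w].

(* Junk value 0 if u is not Bochner integrable on D. *)
Definition bochner_integral D u : V := xget 0 (is_bochner_integral D u).

Definition L1 D u :=
  strongly_measurable D u /\ (\int[mu]_(x in D) `|u x|%:E < +oo)%E.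

End bochner.

Section radon_nikodym_property.
Context {R : realType}.

Definition is_vector_measure d (S : measurableType d)
    (V : completeNormedModType R) (nu : set S -> V) :=
  forall F : (set S)^nat, (forall i, measurable (F i)) -> trivIset setT F ->
    \sum_(i < k) nu (F i) @[k --> \oo] --> nu (\bigcup_i F i).

Definition finite_partition d (S : measurableType d) (k : nat)
    (F : (set S)^nat) :=
  [/\ forall i, measurable (F i), trivIset `I_k F &
      \bigcup_(i in `I_k) F i = setT].

Definition vector_total_variation d (S : measurableType d)
    (V : completeNormedModType R) (nu : set S -> V) : \bar R :=
  ereal_sup [set (\sum_(i < p.1) `|nu (p.2 i)|)%:E |
    p in [set p : nat * (set S)^nat | finite_partition p.1 p.2]].

Definition vector_abs_continuous d (S : measurableType d)
    (V : completeNormedModType R) (nu : set S -> V)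
    (mu : {measure set S -> \bar R}) :=
  forall A, measurable A -> mu A = 0%E -> nu A = 0.

Definition radon_nikodym_property (V : completeNormedModType R) :=
  forall (d : measure_display) (S : measurableType d)
    (mu : {sigma_finite_measure set S -> \bar R}) (nu : set S -> V),
  measure_is_complete mu ->
  is_vector_measure nu -> (vector_total_variation nu < +oo)%E ->
  vector_abs_continuous nu mu ->
  exists f : S -> V, L1 mu setT f /\
    forall A, measurable A -> nu A = bochner_integral mu A f.

End radon_nikodym_property.

Section function_spaces.
Context {R : realType} {n : nat}.
Local Notation T := 'rV[R]_n.+1.
Local Notation leb := (@lebesgue_rV R n).

(* The norm of f, with value +oo when f does not belong to the space X. *)
Definition extended_norm (X : set (T -> R)) (N : (T -> R) -> R) (f : T -> R)
  : \bar R := if `[< X f >] then (N f)%:E else +oo%E.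

(* Elements of M(Om) are represented by functions on R^n, of which only the
   values on Om matter; [bfs_ae] expresses that functions equal a.e. on Om are
   identified. *)
Record banach_function_space (Om : set T) := BanachFunctionSpace {
  bfs_set : set (T -> R);
  bfs_norm : (T -> R) -> R;
  bfs_measurable : forall f : T -> R, bfs_set f -> measurable_fun Om f;
  bfs_ae : forall f g : T -> R, measurable_fun Om g -> bfs_set f ->
    (\forall x \ae leb, Om x -> f x = g x) ->
    bfs_set g /\ bfs_norm g = bfs_norm f;
  bfs_zero : bfs_set (fun=> 0);
  bfs_add : forall f g : T -> R, bfs_set f -> bfs_set g ->
    bfs_set (fun x => f x + g x);
  bfs_scale : forall (c : R) (f : T -> R), bfs_set f ->
    bfs_set (fun x => c * f x);
  bfs_normD : forall f g : T -> R, bfs_set f -> bfs_set g ->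
    bfs_norm (fun x => f x + g x) <= bfs_norm f + bfs_norm g;
  bfs_normZ : forall (c : R) (f : T -> R), bfs_set f ->
    bfs_norm (fun x => c * f x) = `|c| * bfs_norm f;
  bfs_norm0_eq0 : forall f : T -> R, bfs_set f -> bfs_norm f = 0 ->
    \forall x \ae leb, Om x -> f x = 0;
  bfs_complete : forall f_ : nat -> T -> R, (forall k, bfs_set (f_ k)) ->
    (forall e : R, 0 < e -> exists m, forall p q, (m <= p)%N -> (m <= q)%N ->
       bfs_norm (fun x => f_ p x - f_ q x) < e) ->
    exists2 f : T -> R, bfs_set f &
      bfs_norm (fun x => f_ k x - f x) @[k --> \oo] --> (0 : R);
  bfs_P1 : forall f g : T -> R, measurable_fun Om f -> bfs_set g ->
    (\forall x \ae leb, Om x -> `|f x| <= g x) ->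
    bfs_set f /\ bfs_norm f <= bfs_norm g;
  bfs_P2 : forall (f_ : nat -> T -> R) (f : T -> R),
    (forall k, measurable_fun Om (f_ k)) -> measurable_fun Om f ->
    (\forall x \ae leb, Om x ->
       [/\ forall k, 0 <= f_ k x, nondecreasing_seq (f_ ^~ x) &
           f_ k x @[k --> \oo] --> f x]) ->
    nondecreasing_seq (fun k => extended_norm bfs_set bfs_norm (f_ k)) /\
    extended_norm bfs_set bfs_norm (f_ k) @[k --> \oo] -->
      extended_norm bfs_set bfs_norm f;
  bfs_P3 : forall A : set T, measurable A -> A `<=` Om -> (leb A < +oo)%E ->
    bfs_set \1_A;
  bfs_P4 : forall A : set T, measurable A -> A `<=` Om -> (leb A < +oo)%E ->
    exists2 C : R, 0 < C & forall f : T -> R, bfs_set f ->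
      (\int[leb]_(x in A) `|f x|%:E <=
       C%:E * extended_norm bfs_set bfs_norm (fun x => f x * \1_A x)%R)%E
}.

Definition partial (j : 'I_n.+1) (f : T -> R^o) : T -> R^o :=
  'D_(delta_mx ord0 j) f.

Definition smooth (f : T -> R^o) :=
  forall (js : seq 'I_n.+1), let g := foldr partial f js in
    continuous g /\ forall j x, derivable g x (delta_mx ord0 j).

Definition test_function (Om : set T) (phi : T -> R^o) :=
  [/\ smooth phi, compact (closure [set x | phi x != 0]) &
      closure [set x | phi x != 0] `<=` Om].

Section vector_valued.
Context (Om : set T) (X : banach_function_space Om).
Context (V : completeNormedModType R).
Implicit Types u w : T -> V.

Definition in_XV u :=
  strongly_measurable leb Om u /\ bfs_set X (fun x => `|u x|).

Definition normXV u : R := bfs_norm X (fun x => `|u x|).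

Definition L1_loc u := strongly_measurable leb Om u /\
  forall K, compact K -> K `<=` Om -> (\int[leb]_(x in K) `|u x|%:E < +oo)%E.

Definition is_weak_partial (j : 'I_n.+1) u w :=
  [/\ L1_loc u, L1_loc w & forall phi, test_function Om phi ->
    bochner_integral leb Om (fun x => partial j phi x *: u x) =
    - bochner_integral leb Om (fun x => phi x *: w x)].

(* A representative of the weak derivative, which is unique up to equality
   a.e. on Om. *)
Definition weak_partial (j : 'I_n.+1) u : T -> V :=
  xget (fun=> 0) (is_weak_partial j u).

Definition grad_norm u (x : T) : R :=
  Num.sqrt (\sum_(j < n.+1) `|weak_partial j u x| ^+ 2).

Definition W1X u := in_XV u /\
  forall j, (exists w, is_weak_partial j u w) /\ in_XV (weak_partial j u).

Definition W1X_norm u : R := normXV u + bfs_norm X (grad_norm u).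

End vector_valued.

Section reshetnyak.
Context (Om : set T) (X : banach_function_space Om).
Context (V : completeNormedModType R).
Implicit Types u : T -> V.

Definition dual_norm (f : {linear V -> R^o}) : \bar R :=
  ereal_sup [set `|f v|%:E | v in [set v : V | `|v| <= 1]].

Definition dual_unit_ball (f : {linear V -> R^o}) :=
  continuous f /\ (dual_norm f <= 1)%E.

Definition reshetnyak_upper_gradient u (g : T -> R) :=
  [/\ bfs_set X g, \forall x \ae leb, Om x -> 0 <= g x &
      forall f, dual_unit_ball f ->
        \forall x \ae leb, Om x -> grad_norm Om (f \o u) x <= g x].

Definition R1X u :=
  [/\ in_XV X u, forall f, dual_unit_ball f -> W1X X (f \o u) &
      exists g, reshetnyak_upper_gradient u g].

Definition R1X_norm u : R :=
  normXV X u + inf (bfs_norm X @` reshetnyak_upper_gradient u).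

End reshetnyak.

End function_spaces.

(* Main.v *)
Require Import Defs.
From HB Require Import structures.
From mathcomp Require Import all_boot all_order all_algebra.
From mathcomp Require Import all_classical all_reals all_analysis.
From mathcomp Require Import measurable_realfun.
From mathcomp Require Import ring lra.
Set Implicit Arguments.
Unset Strict Implicit.
Unset Printing Implicit Defensive.
Import Order.TTheory GRing.Theory Num.Theory.
Import numFieldNormedType.Exports.
Import HBSimple.
Local Open Scope classical_set_scope.
Local Open Scope ring_scope.

(* Part 1: a functional [f] in the dual unit ball commutes with the Bochner
   integral, so [f] applied to the weak gradient of [u] is a weak gradient of
   [f \o u]; weak gradients of scalar functions are unique almost everywhere.

   Part 2: let [g] be an upper gradient of [u]. For a test function [phi], the
   vector [- \int (D_j phi) u] is mapped by every functional [f] to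
   [\int phi D_j (f \o u)], hence by Hahn-Banach its norm is at most
   [\int |phi| g]. This estimate extends the map [phi |-> - \int (D_j phi) u] to
   [rho * 1_A] for all measurable sets [A], where [rho > 0] is fixed and such that
   [rho * g] is integrable, and makes it a vector measure of bounded variation in
   [A]. Its Radon-Nikodym density divided by [rho] is the weak derivative, whose
   norm is at most [g] a.e. because countably many functionals norm its values.

   Test functions are only needed to approximate the indicator functions of
   boxes, which products of one-dimensional bumps built from [exp(-1/t)] do. *)

(** * Norming functionals *)

Section hahn_banach.
Context {R : realType}.

(** Three obstacles shape part 2. The weak partial of [f \o u] is defined up to a null set that
    depends on [f], so a derivative with values in [V] cannot be assembled pointwise from these real
    functions. Vectors are therefore described by real integrals: [dual_mean h e] says that, for
    every [f], the value [f e] is the integral of [h] times the partial of [f \o u]. Functionals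
    separate points, so [h] determines [e]; the majorant [g], common to all [f], gives a norm
    estimate, and completeness of [V] carries existence from test functions to dominated limits.
    Next, (P4) makes [g] locally integrable only, so without the weight [rho] the vector measure
    could have infinite variation or be undefined on large sets. Finally, the measurable sets are
    those of Caratheodory, so an induction starting from boxes has to end with the removal of a null
    set. The factor [sqrt n] arises because each partial is bounded by [g] separately, possibly
    through different functionals at the same point: the gradient norm is the root of a sum of [n]
    squares, each at most [g ^+ 2]. *)

Definition sublinear (V : lmodType R) (p : V -> R) :=
  (forall x y, p (x + y) <= p x + p y) /\
  (forall s x, 0 < s -> p (s *: x) <= s * p x).

(** The one-sided inequality at [s^-1] gives the converse for [s > 0]; the factors [2] and [1/2]
    force [p 0 = 0], which settles [s = 0]. *)
Lemma sublinearZ (V : lmodType R) (p : V -> R) (s : R) (x : V) :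
  sublinear p -> 0 <= s -> p (s *: x) = s * p x.
Proof.
case=> pD pZ; rewrite le_eqVlt => /predU1P[<-|s0].
  have := pZ 2 0 ltac:(lra); have := pZ 2^-1 0 ltac:(lra).
  by rewrite !scaler0 scale0r mul0r; lra.
apply/eqP; rewrite eq_le pZ//=.
have := pZ s^-1 (s *: x); rewrite invr_gt0 s0 scalerA mulVf ?gt_eqF// scale1r.
by move=> /(_ isT); rewrite mulrC ler_pdivlMr// mulrC.
Qed.

Lemma sublinear0 (V : lmodType R) (p : V -> R) : sublinear p -> p 0 = 0.
Proof. by move=> sp; rewrite -(scale0r 0) sublinearZ// mul0r. Qed.

Definition push_set (V : lmodType R) (p : V -> R) (y x : V) : set R :=
  [set p (x + t *: y) - t * p y | t in [set t | 0 <= t]].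

(* Below [p], and equal to [p] only if [p (x + y) = p x + p y] for all [x]. *)
Definition push (V : lmodType R) (p : V -> R) (y x : V) : R :=
  inf (push_set p y x).

Lemma push_has_inf (V : lmodType R) (p : V -> R) (y x : V) :
  sublinear p -> has_inf (push_set p y x).
Proof.
move=> sp; split; first by exists (p (x + 0 *: y) - 0 * p y), 0 => /=.
(* Lower bound: [t * p y = p ((x + t *: y) - x) <= p (x + t *: y) + p (- x)]. *)
exists (- p (- x)) => _ [t /= t0 <-].
have := sp.1 (x + t *: y) (- x).
by rewrite addrAC subrr add0r sublinearZ//; lra.
Qed.

Lemma push_le (V : lmodType R) (p : V -> R) (y x : V) (t : R) :
  sublinear p -> 0 <= t -> push p y x <= p (x + t *: y) - t * p y.
Proof.
move=> sp t0; apply: ge_inf; first by case: (push_has_inf y x sp).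
by exists t.
Qed.

Lemma push_ge (V : lmodType R) (p : V -> R) (y x : V) (r : R) :
  sublinear p -> (forall t, 0 <= t -> r <= p (x + t *: y) - t * p y) ->
  r <= push p y x.
Proof.
move=> sp H; apply: lb_le_inf; first by case: (push_has_inf y x sp).
by move=> _ [t /= t0 <-]; exact: H.
Qed.

(** If [t] and [t'] are nearly optimal for [x] and [z], then [t + t'] competes for [x + z]; likewise
    [s * t] competes for [s *: x]. *)
Lemma sublinear_push (V : lmodType R) (p : V -> R) (y : V) :
  sublinear p -> sublinear (push p y).
Proof.
move=> sp; split=> [x z|s x s0].
  rewrite -lerBlDr; apply: push_ge => // t t0.
  rewrite lerBlDr -lerBlDl; apply: push_ge => // t' t'0.
  rewrite lerBlDl; apply: (le_trans (@push_le V p y (x + z) (t + t') sp _)).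
    exact: addr_ge0.
  have := sp.1 (x + t *: y) (z + t' *: y).
  by rewrite addrACA -scalerDl; lra.
rewrite -ler_pdivrMl//; apply: push_ge => // t t0.
rewrite ler_pdivrMl//.
apply: (le_trans (@push_le V p y (s *: x) (s * t) sp _)).
  by rewrite mulr_ge0// ltW.
by rewrite -scalerA -scalerDr sublinearZ// ?(ltW s0)//; lra.
Qed.

Lemma push_le_id (V : lmodType R) (p : V -> R) (y x : V) :
  sublinear p -> push p y x <= p x.
Proof.
move=> sp; have := @push_le V p y x 0 sp (lexx _).
by rewrite scale0r addr0 mul0r subr0.
Qed.

(** Zorn's lemma for the reversed pointwise order: a nonempty chain is bounded by its pointwise
    infimum, which is finite because every member is at least [- p0 (- x)] at [x]. *)
Lemma exists_minimal_sublinear (V : lmodType R) (p0 : V -> R) :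
  sublinear p0 ->
  exists p : V -> R, [/\ sublinear p, forall x, p x <= p0 x &
    forall q, sublinear q -> (forall x, q x <= p x) -> q = p].
Proof.
move=> sp0.
pose T := {p : V -> R | sublinear p /\ forall x, p x <= p0 x}.
pose Rel (p q : T) := `[< forall x, sval q x <= sval p x >].
have [||||t tmin] := @Zorn T Rel.
- by move=> p; apply/asboolP.
- move=> p q r /asboolP pq /asboolP qr; apply/asboolP => x.
  exact: le_trans (qr x) (pq x).
- move=> [p ?] [q ?] /asboolP pq /asboolP qp; apply: eq_exist => /=.
  by apply/funext => x; apply/eqP; rewrite eq_le; apply/andP; split;
    [exact: qp|exact: pq].
- move=> A totA.
  have [[a Aa]|noA] := pselect (exists a, A a); last first.
    exists (exist _ p0 (conj sp0 (fun x => lexx _))) => s As.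
    by exfalso; apply: noA; exists s.
  pose E x := [set sval s x | s in A].
  have Ei x : has_inf (E x).
    split; first by exists (sval a x), a.
    exists (- p0 (- x)) => _ [s As <-].
    have [[sD sZ] sle] := svalP s.
    have := sD x (- x); rewrite subrr (sublinear0 (svalP s).1).
    by have := sle (- x); lra.
  pose p x := inf (E x).
  have ple s x : A s -> p x <= sval s x.
    by move=> As; apply: ge_inf; [case: (Ei x)|exists s].
  have pge (r : R) x : (forall s, A s -> r <= sval s x) -> r <= p x.
    move=> H; apply: lb_le_inf; first by case: (Ei x).
    by move=> _ [s As <-]; exact: H.
  have sp : sublinear p.
    split=> [x y|s x s0].
      rewrite -lerBlDr; apply: (pge) => s As.
      rewrite lerBlDr -lerBlDl; apply: (pge) => s' As'.
      (* Of the members chosen for [x] and for [y], the smaller one serves for both, since the chain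
         is totally ordered. *)
      rewrite lerBlDl; have [/asboolP ss'|/asboolP ss'] := totA _ _ As As'.
        apply: le_trans (ple _ _ As') _; apply: le_trans ((svalP s').1.1 _ _) _.
        by have := ss' x; lra.
      apply: le_trans (ple _ _ As) _; apply: le_trans ((svalP s).1.1 _ _) _.
      by have := ss' y; lra.
    rewrite -ler_pdivrMl//; apply: (pge) => q Aq; rewrite ler_pdivrMl//.
    by apply: le_trans (ple _ _ Aq) _; exact: (svalP q).1.2.
  have p_le x : p x <= p0 x by apply: le_trans (ple _ _ Aa) ((svalP a).2 x).
  by exists (exist _ p (conj sp p_le)) => s As; apply/asboolP => x /=; exact: ple.
exists (sval t); split; [exact: (svalP t).1|exact: (svalP t).2|].
move=> q sq qt.
have qp0 x : q x <= p0 x by apply: le_trans (qt x) ((svalP t).2 x).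
have /(congr1 sval) := tmin (exist _ q (conj sq qp0)) (asboolT qt); exact.
Qed.

(* Minimality forces [push p y = p], whose value at [t = 1] is
   superadditivity. *)
Lemma minimal_sublinear_linear (V : lmodType R) (p : V -> R) :
  sublinear p ->
  (forall q, sublinear q -> (forall x, q x <= p x) -> q = p) ->
  linear (p : V -> R^o).
Proof.
move=> sp pmin.
have pD x y : p (x + y) = p x + p y.
  apply/eqP; rewrite eq_le sp.1/=.
  have := @push_le V p y x 1 sp ler01.
  rewrite (pmin _ (sublinear_push y sp)).
    by rewrite scale1r mul1r; lra.
  by move=> z; exact: push_le_id.
have pN x : p (- x) = - p x.
  by have := pD x (- x); rewrite subrr sublinear0//; lra.
move=> a x y; rewrite pD; congr (_ + _).
have [a0|/ltW a0] := leP 0 a; first exact: sublinearZ.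
by rewrite -[LHS]opprK -pN -scaleNr sublinearZ ?oppr_ge0// mulNr opprK.
Qed.

Lemma dual_unit_ballP (V : completeNormedModType R) (f : {linear V -> R^o}) :
  dual_unit_ball f <-> forall x, `|f x| <= `|x|.
Proof.
split=> [[_ f1] x|fle].
  have [->|x0] := eqVneq x 0; first by rewrite linear0 !normr0.
  have nx0 : 0 < `|x| by rewrite normr_gt0.
  have : (`|f (`|x|^-1 *: x)|%:E <= 1)%E.
    apply: le_trans f1; apply: ereal_sup_ubound; exists (`|x|^-1 *: x) => //=.
    by rewrite normrZ normfV normr_id mulVf// gt_eqF.
  by rewrite lee_fin linearZ normrZ normfV normr_id ler_pdivrMl// mulr1.
split.
  apply/linear_bounded_continuous/linear_boundedP.
  exists 1; split => // r /ltW r1 x; apply: le_trans (fle x) _.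
  by rewrite ler_peMl.
apply: ge_ereal_sup => _ [v /= v1 <-]; rewrite lee_fin.
exact: le_trans (fle v) v1.
Qed.

(** Pushing the norm [N] along [v] before minimising forces the value at [v]: a functional below
    [push N v] is at most [N (- v + v) - N v = - N v] at [- v], hence at least [N v] at [v], while
    it stays below [N] everywhere. *)
Lemma norming_functional (V : completeNormedModType R) (v : V) :
  exists2 f : {linear V -> R^o}, dual_unit_ball f & f v = `|v|.
Proof.
pose N (x : V) : R := `|x|.
have sN : sublinear N.
  by split=> [x y|s x s0]; [exact: ler_normD|rewrite /N normrZ gtr0_norm].
have [p [sp ple pmin]] := exists_minimal_sublinear (sublinear_push v sN).
have lp := minimal_sublinear_linear sp pmin.
pose f : {linear V -> R^o} := HB.pack (p : V -> R^o)
  (GRing.isLinear.Build R V R^o _ (p : V -> R^o) lp).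
have pN x : p x <= `|x| by apply: le_trans (ple x) (push_le_id v x sN).
have fN x : p (- x) = - p x by rewrite -[p]/(f : V -> R) linearN.
exists f.
  apply/dual_unit_ballP => x; rewrite ler_norml pN andbT.
  by rewrite lerNl -fN -(normrN x) pN.
apply/eqP; rewrite eq_le pN/=.
have := le_trans (ple (- v)) (@push_le V N v (- v) 1 sN ler01).
by rewrite fN scale1r addNr /N normr0 mul1r sub0r lerN2.
Qed.

Lemma eq_dual (V : completeNormedModType R) (v w : V) :
  (forall f : {linear V -> R^o}, dual_unit_ball f -> f v = f w) -> v = w.
Proof.
move=> H; have [f fb fvw] := norming_functional (v - w).
apply/eqP; rewrite -subr_eq0 -normr_eq0 -fvw linearB/= H// subrr//.
Qed.

Lemma le_dual (V : completeNormedModType R) (v : V) (r : R) :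
  (forall f : {linear V -> R^o}, dual_unit_ball f -> f v <= r) -> `|v| <= r.
Proof. by move=> H; have [f fb <-] := norming_functional v; exact: H. Qed.

End hahn_banach.

(** * Lebesgue measure of boxes and open sets *)

Section lebesgue_boxes.
Context {R : realType} {n : nat}.
Local Notation T := 'rV[R]_n.+1.
Local Notation leb := (@lebesgue_rV R n).

Definition set_coord (i : 'I_n.+1) (c : R) (a : T) : T :=
  \row_j (if j == i then c else a ord0 j).

Lemma box_volume_split (i : 'I_n.+1) (a b : T) (m : R) :
  box_volume (a, b) =
  box_volume (a, set_coord i m b) + box_volume (set_coord i m a, b).
Proof.
rewrite /box_volume (bigD1 i)//= [X in _ = X + _](bigD1 i)//=.
rewrite [X in _ = _ + X](bigD1 i)//= !mxE eqxx.
have E (f g : 'I_n.+1 -> R) : (forall j, j != i -> f j = g j) ->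
    \prod_(j < n.+1 | j != i) f j = \prod_(j < n.+1 | j != i) g j.
  by move=> fg; exact: eq_bigr.
rewrite [X in _ = _ * X + _](E _ (fun j => b ord0 j - a ord0 j)); last first.
  by move=> j /negbTE ji; rewrite !mxE ji.
rewrite [X in _ = _ + _ * X](E _ (fun j => b ord0 j - a ord0 j)); last first.
  by move=> j /negbTE ji; rewrite !mxE ji.
by ring.
Qed.

(** Caratheodory's criterion: the hyperplane cuts every box of a cover into two boxes whose volumes
    add up exactly. *)
Lemma measurable_coord_le (i : 'I_n.+1) (c : R) :
  measurable [set x : T | x ord0 i <= c].
Proof.
apply: le_caratheodory_measurable => X.
apply: le_ereal_inf_tmp => _ [F [leF XF] <-].
(* The threshold [c] clamped to the side of the box, so that both pieces keep ordered corners; a box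
   that the hyperplane misses is cut into itself and a degenerate box. *)
pose m k := Num.max ((F k).1 ord0 i) (Num.min ((F k).2 ord0 i) c).
have mF k : (F k).1 ord0 i <= m k <= (F k).2 ord0 i.
  by rewrite /m le_max lexx/= ge_max leF ge_min lexx.
pose F1 k := ((F k).1, set_coord i (m k) (F k).2).
pose F2 k := (set_coord i (m k) (F k).1, (F k).2).
set H := [set x : T | x ord0 i <= c].
have c1 : box_cover (X `&` H) F1.
  split=> [k j|x [Xx Hx]].
    by rewrite !mxE; case: eqP => [->|_]; [case/andP: (mF k)|exact: leF].
  have [k _ Fkx] := XF _ Xx; exists k => // j; rewrite /= !mxE.
  have /andP[lj uj] := Fkx j; rewrite lj; case: eqP => [ji|_]; last exact: uj.
  by move: lj uj; rewrite ji => lj uj; rewrite /m le_max le_min uj Hx orbT.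
have c2 : box_cover (X `&` ~` H) F2.
  split=> [k j|x [Xx /negP]]; last rewrite -ltNge => /ltW Hx.
    by rewrite !mxE; case: eqP => [->|_]; [case/andP: (mF k)|exact: leF].
  have [k _ Fkx] := XF _ Xx; exists k => // j; rewrite /= !mxE.
  have /andP[lj uj] := Fkx j; rewrite uj andbT; case: eqP => [ji|_]; last exact: lj.
  by move: lj uj; rewrite ji => lj uj; rewrite /m ge_max lj ge_min Hx orbT.
have -> : (\sum_(k <oo) (box_volume (F k))%:E =
    \sum_(k <oo) (box_volume (F1 k))%:E + \sum_(k <oo) (box_volume (F2 k))%:E)%E.
  rewrite -nneseriesD; last 2 first.
  - by move=> k _ _; rewrite lee_fin (box_volume_ge0 _ c1).
  - by move=> k _ _; rewrite lee_fin (box_volume_ge0 _ c2).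
  apply: eq_eseriesr => k _; rewrite -EFinD -box_volume_split.
  by rewrite -surjective_pairing.
by apply: leeD; apply: ereal_inf_lbound; [exists F1|exists F2].
Qed.

Lemma measurable_coord_lt (i : 'I_n.+1) (c : R) :
  measurable [set x : T | x ord0 i < c].
Proof.
rewrite (_ : mkset _ = \bigcup_k [set x : T | x ord0 i <= c - k.+1%:R^-1]).
  by apply: bigcupT_measurable => k; exact: measurable_coord_le.
apply/seteqP; split=> x /=.
  rewrite -subr_gt0 => /ltr_add_invr[k]; rewrite add0r => xk.
  by exists k => //=; rewrite lerBrDr -lerBrDl ltW.
by move=> [k _ /= /le_lt_trans]; apply; rewrite gtrBl.
Qed.

Definition open_box (a b : T) : set T :=
  [set x | forall i, a ord0 i < x ord0 i < b ord0 i].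

Lemma measurable_box (ab : T * T) : measurable (box ab).
Proof.
rewrite (_ : box ab = \bigcap_(i in [set: 'I_n.+1])
    ([set x : T | x ord0 i <= ab.2 ord0 i] `&` ~` [set x : T | x ord0 i < ab.1 ord0 i])).
  apply: fin_bigcap_measurable => // i _; apply: measurableI.
    exact: measurable_coord_le.
  by apply: measurableC; exact: measurable_coord_lt.
apply/seteqP; split=> x.
  by move=> xab i _; have /andP[? ?] := xab i; split => //=; apply/negP; rewrite -leNgt.
move=> xab i; have [/= -> /negP] := xab i Logic.I.
by rewrite -leNgt => ->.
Qed.

Lemma measurable_open_box (a b : T) : measurable (open_box a b).
Proof.
rewrite (_ : open_box a b = \bigcap_(i in [set: 'I_n.+1])
    ([set x : T | x ord0 i < b ord0 i] `&` ~` [set x : T | x ord0 i <= a ord0 i])).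
  apply: fin_bigcap_measurable => // i _; apply: measurableI.
    exact: measurable_coord_lt.
  by apply: measurableC; exact: measurable_coord_le.
apply/seteqP; split=> x.
  by move=> xab i _; have /andP[? ?] := xab i; split => //=; apply/negP; rewrite -ltNge.
move=> xab i; have [/= -> /negP] := xab i Logic.I.
by rewrite -ltNge => ->.
Qed.

Lemma lebesgue_box_le (a b : T) : (forall i, a ord0 i <= b ord0 i) ->
  (leb (box (a, b)) <= (box_volume (a, b))%:E)%E.
Proof.
(* The cover is padded with degenerate boxes [(a, a)], of volume 0 since the dimension is
   positive. *)
move=> ab; pose F k : T * T := if k == 0%N then (a, b) else (a, a).
apply: (@le_trans _ _ (\sum_(k <oo) (box_volume (F k))%:E)%E).
  apply: ereal_inf_lbound; exists F => //; split=> [k i|x xab].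
    by rewrite /F; case: ifP => _ /=.
  by exists 0%N.
rewrite (@nneseries_split _ _ 0 1)//; last first.
  move=> k _; rewrite lee_fin; apply: prodr_ge0 => i _.
  by rewrite /F; case: ifP => _ /=; rewrite subr_ge0.
rewrite big_mkord big_ord1 eseries0 ?adde0// => -[//|k] _ _.
by rewrite /box_volume big_ord_recl /= subrr mul0r.
Qed.

Lemma lebesgue_box_lty (a b : T) : (leb (box (a, b)) < +oo)%E.
Proof.
have [ab|] := pselect (forall i, a ord0 i <= b ord0 i).
  exact: le_lt_trans (lebesgue_box_le ab) (ltry _).
move=> /existsNP[i /negP]; rewrite -ltNge => ba.
rewrite (_ : box _ = set0) ?measure0//; apply/seteqP; split => // x /(_ i) /=.
by case/andP => ax /(le_trans ax); rewrite leNgt ba.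
Qed.

Lemma open_box_sub (a b : T) : open_box a b `<=` box (a, b).
Proof. by move=> x xab i; have /andP[/ltW /= -> /ltW ->] := xab i. Qed.

Lemma compact_box (ab : T * T) : compact (box ab).
Proof.
pose A (i : 'I_n.+1) : set R := `[ab.1 ord0 i, ab.2 ord0 i]%classic.
rewrite (_ : box ab = [set v : T | forall i, A i (v ord0 i)]).
  by apply: rV_compact => i; exact: segment_compact.
by apply/seteqP; split=> x xab i; have := xab i; rewrite /A /= in_itv.
Qed.

Lemma closed_box (ab : T * T) : closed (box ab).
Proof. apply: compact_closed; [exact: norm_hausdorff|exact: compact_box]. Qed.


Lemma open_box_nbhs (x : T) (A : set T) : nbhs x A ->
  exists2 e : R, 0 < e &
    forall y : T, (forall i, `|x ord0 i - y ord0 i| < e) -> A y.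
Proof.
move=> /nbhs_ballP[e /= e0 eA]; exists e => // y xy; apply: eA; split => // i j.
by rewrite (ord1 i); exact: xy.
Qed.

(** The closed boxes provide compact subsets of [A], while their interiors already exhaust [A]. They
    are the cubes with rational centre and radius [1 / (m + 1)]. *)
Lemma open_box_cover (A : set T) : open A -> exists F : (T * T)^nat,
  (forall k, box (F k) `<=` A) /\ A = \bigcup_k open_box (F k).1 (F k).2.
Proof.
move=> oA.
pose c (q : 'rV[rat]_n.+1) (m : nat) : T * T :=
  (\row_i (ratr (q ord0 i) - m.+1%:R^-1), \row_i (ratr (q ord0 i) + m.+1%:R^-1)).
(* An index that encodes no cube, or a cube that leaves [A], receives an empty box: its lower corner
   lies above its upper one. *)
pose F k : T * T := if @unpickle ('rV[rat]_n.+1 * nat)%type k is Some (q, m) then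
    if `[< box (c q m) `<=` A >] then c q m else (const_mx 1, 0)
  else (const_mx 1, 0).
have b10 : box (const_mx 1, 0) `<=` A.
  by move=> x /(_ ord0); rewrite !mxE /= => /andP[/le_trans h /h]; rewrite ler10.
have FA k : box (F k) `<=` A.
  by rewrite /F; case: unpickle => [[q m]|//]; case: asboolP.
exists F; split=> //; apply/seteqP; split; last first.
  by move=> x [k _ /open_box_sub]; rewrite -surjective_pairing => /FA.
move=> x Ax; have [e e0 eA] := open_box_nbhs (open_nbhs_nbhs (conj oA Ax)).
(* A cube of radius [r < e / 2] whose centre is within [r] of [x] stays within [e] of [x]. *)
have /ltr_add_invr[m] : 0 < e / 2 by rewrite divr_gt0.
rewrite add0r => me.
have m0 : (0 : R) < m.+1%:R^-1 by rewrite invr_gt0.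
have /choice[q qx] (i : 'I_n.+1) : exists q : rat, `|x ord0 i - ratr q| < m.+1%:R^-1.
  have [q] := @rat_in_itvoo R (x ord0 i - m.+1%:R^-1) (x ord0 i + m.+1%:R^-1)
    ltac:(by rewrite ltrD2l gtrN).
  by rewrite in_itv /= => qi; exists q; rewrite ltr_distlC.
exists (pickle ((\row_i q i : 'rV[rat]_n.+1), m)) => //.
rewrite /F pickleK; case: asboolP => [_ i|[]].
  by rewrite /= !mxE; have := qx i; rewrite ltr_distl.
move=> y yc; apply: eA => i; have := yc i; have := qx i.
rewrite /= !mxE !ltr_distl => /andP[+ +] /andP[+ +].
move: me; move: (m.+1%:R^-1) (ratr (q i)) => r z *.
by apply/andP; split; lra.
Qed.

Lemma open_measurable_rV (A : set T) : open A -> measurable A.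
Proof.
move=> /open_box_cover[F [_ ->]]; apply: bigcupT_measurable => k.
exact: measurable_open_box.
Qed.

Lemma closed_measurable_rV (A : set T) : closed A -> measurable A.
Proof.
by move=> cA; rewrite -(setCK A); apply/measurableC/open_measurable_rV/closed_openC.
Qed.

Lemma coord_le_norm (x : T) (i : 'I_n.+1) : `|x ord0 i| <= `|x|.
Proof.
rewrite [leRHS]/Num.norm /= mx_normE.
exact: (le_bigmax _ (fun i : 'I_1 * 'I_n.+1 => `|x i.1 i.2|%:nng) (ord0, i)).
Qed.

Lemma compact_lebesgue_lty (K : set T) : compact K ->
  measurable K /\ (leb K < +oo)%E.
Proof.
move=> cK; have mK : measurable K.
  apply: closed_measurable_rV; apply: compact_closed; last exact: cK.
  exact: norm_hausdorff.
split=> //; have [M [_ KM]] := compact_bounded cK.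
pose c : T := const_mx (M + 1).
apply: (@le_lt_trans _ _ (leb (box (- c, c)))); last exact: lebesgue_box_lty.
apply: le_lebesgue_outer_rV => x Kx i.
have /= := KM (M + 1) ltac:(by rewrite ltrDl) x Kx.
by move=> /(le_trans (coord_le_norm x i)); rewrite ler_norml !mxE.
Qed.

Lemma lebesgue_rV_complete : measure_is_complete leb.
Proof. exact: measure_is_complete_caratheodory. Qed.

Lemma lebesgue_rV_sigma_finite : sigma_finite setT leb.
Proof.
have oT : open (@setT T) by exact: openT.
have [F [_ FT]] := open_box_cover oT.
exists (fun k => open_box (F k).1 (F k).2) => // k.
split; first exact: measurable_open_box.
apply: le_lt_trans (lebesgue_box_lty (F k).1 (F k).2).
exact/le_lebesgue_outer_rV/open_box_sub.
Qed.

HB.instance Definition _ := @Measure_isSigmaFinite.Build _ T R leb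
  lebesgue_rV_sigma_finite.

(** * Induction over measurable sets *)

Definition open_boxes : set (set T) := [set open_box p.1 p.2 | p in [set: T * T]].

Lemma open_boxes_setI : setI_closed open_boxes.
Proof.
move=> _ _ [[a b] _ <-] [[c d] _ <-].
exists (\row_i Num.max (a ord0 i) (c ord0 i), \row_i Num.min (b ord0 i) (d ord0 i)) => //.
apply/seteqP; split=> x /=.
  by move=> H; split=> i; have := H i; rewrite !mxE gt_max lt_min;
    move=> /andP[/andP[h1 h2] /andP[h3 h4]]; rewrite ?h1 ?h2 ?h3 ?h4.
move=> [ab cd] i; have := ab i; have := cd i.
by rewrite !mxE gt_max lt_min => /andP[-> ->] /andP[-> ->].
Qed.

Lemma box_sigma_open_boxes (ab : T * T) : <<s open_boxes >> (box ab).
Proof.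
pose c k : T := const_mx k.+1%:R^-1.
rewrite (_ : box ab = \bigcap_k open_box (ab.1 - c k) (ab.2 + c k)).
  apply: (@bigcap_measurableType _ (g_sigma_algebraType open_boxes)) => k _.
  by apply: sub_sigma_algebra; exists (ab.1 - c k, ab.2 + c k).
apply/seteqP; split=> x.
  move=> xab k _ i; have /andP[ax bx] := xab i; rewrite !mxE.
  by rewrite ltrBlDr (le_lt_trans ax) ?ltrDl//= (le_lt_trans bx)// ltrDl.
move=> xab i; apply/andP; split; apply/ler_addgt0Pr => e /ltr_add_invr[k];
  rewrite add0r => /ltW ke; have := xab k I i; rewrite !mxE => /andP[].
- by move=> ax _; rewrite -lerBlDr (le_trans _ (ltW ax))// lerD2l lerN2.
- by move=> _ bx; rewrite (le_trans (ltW bx))// lerD2l.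
Qed.

Lemma sigma_open_boxes_measurable : <<s open_boxes >> `<=` measurable.
Proof.
apply: smallest_sub; first exact: sigma_algebra_measurable.
by move=> _ [[a b] _ <-]; exact: measurable_open_box.
Qed.

(** Dynkin's theorem only reaches the sigma-algebra generated by the open boxes, and [G] bridges the
    gap to Caratheodory sets. It is the intersection of box covers of total volume at most
    [leb A + 1 / (m + 1)]. *)
Lemma lebesgue_outer_regular (A : set T) : measurable A -> (leb A < +oo)%E ->
  exists G, [/\ <<s open_boxes >> G, A `<=` G & leb (G `\` A) = 0%E].
Proof.
move=> mA Afin; have Afn : leb A \is a fin_num by rewrite ge0_fin_numE.
have /choice[F FP] (m : nat) : exists F : (T * T)^nat, box_cover A F /\
    (\sum_(k <oo) (box_volume (F k))%:E <= leb A + (m.+1%:R^-1)%:E)%E.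
  have m0 : (0 : R) < m.+1%:R^-1 by rewrite invr_gt0.
  by have [_ [F cF <-] /ltW leF] := lb_ereal_inf_adherent m0 Afn; exists F.
pose G := \bigcap_m \bigcup_k box (F m k).
have sG : <<s open_boxes >> G.
  apply: (@bigcap_measurableType _ (g_sigma_algebraType open_boxes)) => m _.
  apply: (@bigcupT_measurable _ (g_sigma_algebraType open_boxes)) => k.
  exact: box_sigma_open_boxes.
have AG : A `<=` G by move=> x Ax m _; exact: (FP m).1.2.
have mG : measurable G by exact: sigma_open_boxes_measurable.
have GA : (leb G <= leb A)%E.
  apply/lee_addgt0Pr => e /ltr_add_invr[m]; rewrite add0r => /ltW me.
  apply: (@le_trans _ _ (leb A + (m.+1%:R^-1)%:E)%E); last by rewrite leeD2l.
  apply: le_trans (FP m).2; apply: ereal_inf_lbound; exists (F m) => //.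
  by split; [exact: (FP m).1.1|move=> x /(_ m I)].
exists G; split=> //.
rewrite measureD//; last exact: le_lt_trans GA Afin.
rewrite setIidr//= (_ : _ G = leb A) ?subee//.
by apply/eqP; rewrite eq_le GA; exact: le_lebesgue_outer_rV.
Qed.

(** Dynkin's theorem for the traces on [Q] of the sets generated by open boxes, followed by the
    passage from the hull of [A] to [A] itself, which differ by a null set. *)
Lemma lebesgue_dynkin (Q : set T) (P : set T -> Prop) :
  measurable Q -> (leb Q < +oo)%E -> P Q ->
  (forall a b, P (open_box a b `&` Q)) ->
  (forall A B, measurable A -> measurable B -> A `<=` B -> B `<=` Q ->
    P A -> P B -> P (B `\` A)) ->
  (forall F : (set T)^nat, (forall k, measurable (F k)) -> trivIset setT F ->
    (forall k, F k `<=` Q) -> (forall k, P (F k)) -> P (\bigcup_k F k)) ->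
  (forall A B, measurable A -> measurable B -> A `<=` B -> B `<=` Q ->
    leb (B `\` A) = 0%E -> P B -> P A) ->
  forall A, measurable A -> A `<=` Q -> P A.
Proof.
move=> mQ Qfin PQ Pbox PD PU P0 A mA AQ.
have Afin : (leb A < +oo)%E by exact: le_lt_trans (le_lebesgue_outer_rV AQ) Qfin.
have [G [sG AG GA0]] := lebesgue_outer_regular mA Afin.
have mG := sigma_open_boxes_measurable sG.
have : P (G `&` Q).
  apply: (@dynkin_induction _ (g_sigma_algebraType open_boxes) open_boxes
    (fun S => P (S `&` Q))) sG => //.
  - exact: open_boxes_setI.
  - by rewrite setTI.
  - by move=> _ [[a b] _ <-]; exact: Pbox.
  - move=> S /sigma_open_boxes_measurable mS PS.
    rewrite (_ : ~` S `&` Q = Q `\` (S `&` Q)).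
      apply: PD => //; first exact: measurableI.
    by rewrite setDIr setDv setU0 setDE setIC.
  - move=> F mF tF PF; rewrite setI_bigcupl; apply: PU => //.
    + by move=> k; apply: measurableI => //; exact: sigma_open_boxes_measurable (mF k).
    + exact: trivIset_setIr.
apply: P0 => //; first exact: measurableI.
  by move=> x Ax; split; [exact: AG|exact: AQ].
apply: (subset_measure0 _ _ _ GA0).
- by apply: measurableD => //; exact: measurableI.
- exact: measurableD.
- by apply: setSD.
Qed.

End lebesgue_boxes.

(** * Smooth bumps *)

Section smooth_one_variable.
Context {R : realType}.
Implicit Types (f g h : R -> R) (p : {poly R}).

Fixpoint Ck (k : nat) (h : R -> R) : Prop :=
  if k is k'.+1 then
    exists2 h', (forall x, is_derive x (1 : R) (h : R -> R^o) (h' x)) & Ck k' h'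
  else continuous h.

Lemma is_derive_continuous h h' :
  (forall x, is_derive x (1 : R) (h : R -> R^o) (h' x)) -> continuous h.
Proof.
by move=> hh' x; apply/differentiable_continuous/derivable1_diffP; case: (hh' x).
Qed.

Lemma CkW k h : Ck k.+1 h -> Ck k h.
Proof.
elim: k h => [|k IH] h [h' hh' Ch']; first exact: is_derive_continuous hh'.
by exists h' => //; exact: IH.
Qed.

Lemma CkD k f g : Ck k f -> Ck k g -> Ck k (fun x => f x + g x).
Proof.
elim: k f g => [|k IH] f g.
  by move=> cf cg x; apply: cvgD; [exact: cf|exact: cg].
move=> [f' ff' Cf] [g' gg' Cg]; exists (fun x => f' x + g' x); last exact: IH.
by move=> x; apply: is_deriveD.
Qed.

Lemma CkM k f g : Ck k f -> Ck k g -> Ck k (fun x => f x * g x).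
Proof.
elim: k f g => [|k IH] f g.
  by move=> cf cg x; apply: cvgM; [exact: cf|exact: cg].
move=> Cf Cg; have Cf' := CkW Cf; have Cg' := CkW Cg.
case: Cf Cg => f1 ff1 Cf1 [g1 gg1 Cg1].
exists (fun x => f x * g1 x + g x * f1 x).
  by move=> x; apply: is_deriveM.
by apply: CkD; exact: IH.
Qed.

Lemma Ck_cst k (c : R) : Ck k (fun=> c).
Proof.
elim: k c => [|k IH] c; first exact: cst_continuous.
by exists (fun=> 0) => // x; exact: is_derive_cst.
Qed.

Lemma Ck_affine k h (a b : R) : Ck k h -> Ck k (fun x => h (a * x + b)).
Proof.
have ab (x : R) : is_derive x (1 : R) (fun x : R => a * x + b : R^o) a.
  rewrite -[X in is_derive _ _ _ X]addr0 -[X in is_derive _ _ _ (X + _)]mulr1.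
  by apply: is_deriveD; apply: is_deriveZ.
elim: k h => [|k IH] h.
  move=> ch x; apply: (@continuous_comp _ _ _ (fun x => a * x + b) h).
    exact: is_derive_continuous ab x.
  exact: ch.
move=> [h' hh' Ch']; exists (fun x => h' (a * x + b) * a); last first.
  by apply: CkM; [exact: IH|exact: Ck_cst].
by move=> x; apply: (@is_derive1_comp _ h (fun x => a * x + b)).
Qed.

(** The polynomial parameter makes the family of these functions closed under differentiation, which
    replaces p by (p - p') X^2; smoothness is then an induction over all p at once. *)
Definition flat_exp p (t : R) : R :=
  if t <= 0 then 0 else p.[t^-1] * expR (- t^-1).

(** Induction on [p] at half the rate: one factor [expR (e / 2 * s)] bounds the quotient polynomial,
    the other absorbs the new factor [s] through [1 + x <= expR x]. *)
Lemma horner_le_expR p (e : R) : 0 < e ->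
  exists2 C, 0 <= C & forall s, 0 <= s -> `|p.[s]| <= C * expR (e * s).
Proof.
elim/poly_ind: p e => [|p c IH] e e0.
  by exists 0 => // s s0; rewrite horner0 normr0 mul0r.
have e20 : 0 < e / 2 by rewrite divr_gt0.
have [C C0 HC] := IH _ e20.
exists (C * (2 / e) + `|c|) => [|s s0].
  by rewrite addr_ge0// mulr_ge0// divr_ge0// ltW.
have es : 1 <= expR (e * s) by rewrite -expR0 ler_expR mulr_ge0// ltW.
have H : `|p.[s]| * s <= C * (2 / e) * expR (e * s).
  have -> : e * s = e / 2 * s + e / 2 * s by field.
  rewrite expRD; set E := expR _.
  have -> : C * (2 / e) * (E * E) = (C * E) * (2 / e * E) by ring.
  rewrite ler_pM//; first exact: HC.
  rewrite -ler_pdivrMl ?divr_gt0// invf_div.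
  by apply: le_trans (expR_ge1Dx _); rewrite lerDr.
have Hc : `|c| <= `|c| * expR (e * s) by rewrite ler_peMr.
rewrite hornerD hornerMX hornerC; apply: le_trans (ler_normD _ _) _.
rewrite normrM (ger0_norm s0).
by have := lerD H Hc; rewrite -mulrDl.
Qed.

(** Quadratic decay at 0 makes the difference quotient of [flat_exp p] tend to 0 there. It is the
    exponential bound at rate 1 for [p * 'X^2], taken at [t^-1]. *)
Lemma flat_exp_le p : exists C, forall t, `|flat_exp p t| <= C * t ^+ 2.
Proof.
have [C C0 HC] := @horner_le_expR (p * 'X^2) 1 ltr01.
exists C => t; rewrite /flat_exp; case: (leP t 0) => t0.
  by rewrite normr0 mulr_ge0// sqr_ge0.
have := HC t^-1; rewrite invr_ge0 => /(_ (ltW t0)).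
rewrite hornerM hornerXn mul1r normrM (ger0_norm (sqr_ge0 _)) => H.
rewrite normrM (ger0_norm (expR_ge0 _)) expRN.
by rewrite ler_pdivrMr ?expR_gt0// mulrAC -ler_pdivrMr ?exprn_gt0// -exprVn.
Qed.

Lemma is_derive_flat_exp p (t : R) :
  is_derive t (1 : R) (flat_exp p : R -> R^o) (flat_exp ((p - p^`()) * 'X^2) t).
Proof.
have [t0|t0|->] := ltgtP t 0.
- apply: (@near_eq_is_derive _ _ _ (cst 0 : R -> R^o)).
    near=> x; rewrite /flat_exp ifT//; near: x.
    by apply: filterS (lt_nbhsl t0) => x /ltW.
  by rewrite /flat_exp ifT ?ltW//; exact: is_derive_cst.
- apply: (@near_eq_is_derive _ _ _ (fun x : R => p.[x^-1] * expR (- x^-1) : R^o)).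
    near=> x; rewrite /flat_exp ifF//; near: x.
    by apply: filterS (lt_nbhsr t0) => x x0; rewrite leNgt x0.
  have dV : is_derive t (1 : R) (fun x : R => x^-1 : R^o) (- t ^- 2).
    rewrite -[X in is_derive _ _ _ X]mulr1.
    by apply: (@is_deriveV _ id t 1 1) => //; rewrite gt_eqF.
  have dp := @is_derive1_comp _ (horner p) (fun x : R => x^-1) t _ _
    (is_derive_poly p t^-1) dV.
  have dNV : is_derive t (1 : R) (fun x : R => - x^-1 : R^o) (t ^- 2).
    by rewrite -[X in is_derive _ _ _ X]opprK; exact: is_deriveN.
  have dE := @is_derive1_comp _ expR (fun x : R => - x^-1) t _ _
    (is_derive_expR (- t^-1)) dNV.
  have := is_deriveM dp dE; congr is_derive.
  rewrite /flat_exp leNgt t0/= hornerM hornerXn hornerD hornerN exprVn.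
  by rewrite /GRing.scale/=; ring.
- have [C HC] := flat_exp_le p.
  have -> : flat_exp ((p - p^`()) * 'X^2) 0 = 0 by rewrite /flat_exp lexx.
  have f0 : flat_exp p 0 = 0 by rewrite /flat_exp lexx.
  have H : (fun h : R => h^-1 *: (((flat_exp p : R -> R^o) \o shift 0) (h *: 1)
      - flat_exp p 0 : R^o)) @ 0^' --> (0 : R^o).
    apply/cvgr0Pnorm_le => e e0; near=> h.
    have h0 : h != 0 by near: h; exact: nbhs_dnbhs_neq.
    rewrite /= f0 subr0 addr0 [_ *: 1]mulr1 normrZ normfV.
    rewrite ler_pdivrMl ?normr_gt0//.
    apply: (le_trans (HC h)).
    rewrite -(@real_normK _ h) ?num_real// expr2 mulrCA ler_wpM2l//.
    (* The sign of [C] is unknown; its absolute value plus 1 is positive and can be divided by. *)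
    apply: (@le_trans _ _ ((`|C| + 1) * `|h|)).
      by rewrite ler_wpM2r// ler_wpDr// ler_norm.
    rewrite -ler_pdivlMl ?ltr_wpDl//; near: h; apply: dnbhs0_le.
    by rewrite mulr_gt0// invr_gt0 ltr_wpDl.
  by split; [apply/cvg_ex; exists 0|exact: cvg_lim].
Unshelve. all: by end_near. Qed.

Lemma Ck_flat_exp k p : Ck k (flat_exp p).
Proof.
elim: k p => [|k IH] p; first exact: is_derive_continuous (is_derive_flat_exp p).
exists (flat_exp ((p - p^`()) * 'X^2)) => //; exact: is_derive_flat_exp.
Qed.

(* Tends to the indicator function of [`]a, b[] as [k] tends to infinity. *)
Definition bump_itv (k : nat) (a b t : R) : R :=
  flat_exp 1 (k.+1%:R * (t - a)) * flat_exp 1 (k.+1%:R * (b - t)).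

Lemma flat_exp1_itv t : 0 <= flat_exp 1 t <= 1.
Proof.
rewrite /flat_exp; case: (leP t 0) => t0; first by rewrite lexx ler01.
by rewrite hornerC mul1r expR_ge0 -expR0 ler_expR oppr_le0 invr_ge0 ltW.
Qed.

Lemma bump_itv_itv k a b t : 0 <= bump_itv k a b t <= 1.
Proof.
have /andP[? ?] := flat_exp1_itv (k.+1%:R * (t - a)).
have /andP[? ?] := flat_exp1_itv (k.+1%:R * (b - t)).
by rewrite mulr_ge0//= mulr_ile1.
Qed.

Lemma bump_itv_neq0 k a b t : bump_itv k a b t != 0 -> a < t < b.
Proof.
apply: contraR; rewrite negb_and -!leNgt /bump_itv /flat_exp => /orP[ta|bt].
  by rewrite ifT ?mul0r// pmulr_rle0// subr_le0.
by rewrite mulrC ifT ?mul0r// pmulr_rle0// subr_le0.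
Qed.

Lemma Ck_bump_itv k m a b : Ck k (bump_itv m a b).
Proof.
apply: CkM.
  have := @Ck_affine k (flat_exp 1) m.+1%:R (- (m.+1%:R * a)) (Ck_flat_exp k 1).
  by congr Ck; apply/funext => t; rewrite mulrBr.
have := @Ck_affine k (flat_exp 1) (- m.+1%:R) (m.+1%:R * b) (Ck_flat_exp k 1).
by congr Ck; apply/funext => t; rewrite mulrBr mulNr addrC.
Qed.

Lemma cvg_flat_exp1 c : 0 < c -> flat_exp 1 (k.+1%:R * c) @[k --> \oo] --> (1 : R).
Proof.
move=> c0; rewrite (_ : (fun k => _) = (fun k => expR (- (c^-1 * k.+1%:R^-1)))).
  rewrite -[X in _ --> X]expR0; apply: continuous_cvg; first exact: continuous_expR.
  rewrite -oppr0 -(mulr0 c^-1); apply: cvgN; apply: cvgMl_tmp.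
  exact: cvg_harmonic.
apply/funext => k; rewrite /flat_exp leNgt pmulr_rgt0// c0/= hornerC mul1r.
by rewrite invfM mulrC.
Qed.

Lemma cvg_bump_itv a b t :
  bump_itv k a b t @[k --> \oo] --> (if a < t < b then 1 else 0 : R).
Proof.
case: ifPn => [/andP[a_t tb]|ab]; last first.
  rewrite (_ : (fun k => _) = (fun=> 0)); first exact: cvg_cst.
  by apply/funext => k; apply/eqP; apply: contraNT ab; exact: bump_itv_neq0.
by rewrite -[X in _ --> X]mulr1; apply: cvgM; apply: cvg_flat_exp1; rewrite subr_gt0.
Qed.

End smooth_one_variable.

(** * Products of one-variable functions as test functions *)

Section smooth_several_variables.
Context {R : realType} {n : nat}.
Local Notation T := 'rV[R]_n.+1.
Implicit Types (h : 'I_n.+1 -> R -> R).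

Definition smooth1 (h : R -> R) := forall k, Ck k h.

(** The derivative supplied at each order could vary with the order; uniqueness of derivatives
    identifies them all. *)
Lemma smooth1_derive (h : R -> R) : smooth1 h ->
  exists2 h', (forall x, is_derive x (1 : R) (h : R -> R^o) (h' x)) & smooth1 h'.
Proof.
move=> sh; have [h' hh' _] := sh 1%N; exists h' => // k.
have [h2 hh2 Ch2] := sh k.+1; suff -> : h' = h2 by [].
apply/funext => x; have [_ <-] := hh' x; by have [_ <-] := hh2 x.
Qed.

Definition prod_fun h (x : T) : R^o := \prod_i h i (x ord0 i).

Lemma continuous_prod_fun h : (forall i, continuous (h i)) ->
  continuous (prod_fun h).
Proof.
move=> ch; rewrite /prod_fun; elim: (index_enum _) => [|i s IH].
  by under eq_fun do rewrite big_nil; exact: cst_continuous.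
have ci : continuous (fun x : T => h i (x ord0 i)).
  by move=> x; apply: continuous_comp; [exact: coord_continuous|exact: ch].
by under eq_fun do rewrite big_cons; move=> x; exact: (cvgM (ci x) (IH x)).
Qed.

Lemma is_derive_prod_fun h (j : 'I_n.+1) (h' : R -> R) (x : T) :
  (forall t, is_derive t (1 : R) (h j : R -> R^o) (h' t)) ->
  is_derive x (delta_mx ord0 j) (prod_fun h)
    (prod_fun (fun i => if i == j then h' else h i) x).
Proof.
move=> /(_ (x ord0 j)) [dh dhE]; pose r := \prod_(i | i != j) h i (x ord0 i).
have E (f : 'I_n.+1 -> R -> R) (y : T) :
    (forall i, i != j -> f i (y ord0 i) = h i (x ord0 i)) ->
    prod_fun f y = f j (y ord0 j) * r.
  move=> fy; rewrite /prod_fun (bigD1 j)//=; congr (_ * _).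
  by apply: eq_bigr => i ij; exact: fy.
have H : (fun t : R => t^-1 *: ((prod_fun h \o shift x) (t *: delta_mx ord0 j)
     - prod_fun h x : R^o)) @ 0^' -->
     (prod_fun (fun i => if i == j then h' else h i) x : R^o).
  rewrite (E (fun i => if i == j then h' else h i)); last first.
    by move=> i /negbTE ->.
  rewrite eqxx -dhE.
  rewrite (_ : (fun t => _) = (fun t : R =>
      (t^-1 *: ((h j \o shift (x ord0 j)) (t *: (1 : R)) - h j (x ord0 j)) : R^o) * r)).
    by apply: cvgM; [exact: dh|exact: cvg_cst].
  apply/funext => t; rewrite /= (E h x)// (E h).
    by rewrite !mxE !eqxx -mulrBl -scalerAl mulr1n.
  by move=> i /negbTE ij; rewrite !mxE ij andbF mulr0n mulr0 add0r.
by split; [apply/cvg_ex; exists (prod_fun (fun i => if i == j then h' else h i) x)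
  |exact: cvg_lim].
Qed.

(** A partial derivative changes a single factor, so it maps products of smooth one-variable
    functions to such products; hence the induction over the list of directions. *)
Lemma smooth_prod_fun h : (forall i, smooth1 (h i)) -> smooth (prod_fun h).
Proof.
move=> sh js /=.
have [h1 sh1 ->] : exists2 h1, (forall i, smooth1 (h1 i)) &
    foldr partial (prod_fun h) js = prod_fun h1.
  elim: js => [|j js [h1 sh1 /= ->]]; first by exists h.
  have [h' dh' sh'] := smooth1_derive (sh1 j).
  exists (fun i => if i == j then h' else h1 i) => [i|]; first by case: ifP.
  by apply/funext => x; have [_ <-] := is_derive_prod_fun x dh'.
split; first by apply: continuous_prod_fun => i; exact: (sh1 i 0%N).
move=> j x; have [h' dh' sh'] := smooth1_derive (sh1 j).
by have [] := is_derive_prod_fun x dh'.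
Qed.

Definition box_bump (k : nat) (a b : T) : T -> R^o :=
  prod_fun (fun i => bump_itv k (a ord0 i) (b ord0 i)).

Lemma box_bump_itv k (a b x : T) : 0 <= box_bump k a b x <= 1.
Proof.
rewrite /box_bump /prod_fun; elim/big_ind : _ => [|u v /andP[u0 u1] /andP[v0 v1]|i _].
- by rewrite ler01 lexx.
- by rewrite mulr_ge0//= mulr_ile1.
- exact: bump_itv_itv.
Qed.

Lemma box_bump_neq0 k (a b x : T) : box_bump k a b x != 0 -> open_box a b x.
Proof. by move=> /prodf_neq0 H i; apply: (@bump_itv_neq0 _ k); exact: H. Qed.

Lemma cvg_box_bump (a b x : T) :
  box_bump k a b x @[k --> \oo] --> (\1_(open_box a b) x : R).
Proof.
have -> : \1_(open_box a b) x =
    \prod_i (if a ord0 i < x ord0 i < b ord0 i then 1 else 0) :> R.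
  rewrite indicE; case: (boolP (x \in open_box a b)) => [|].
    by rewrite inE => xab; rewrite big1// => i _; rewrite xab.
  rewrite notin_setE => /existsNP[i /negP/negbTE xi].
  by rewrite (bigD1 i)//= xi mul0r.
rewrite /box_bump /prod_fun; elim: (index_enum _) => [|i s IH].
  by rewrite big_nil; under eq_fun do rewrite big_nil; exact: cvg_cst.
rewrite big_cons; under eq_fun do rewrite big_cons.
by apply: cvgM => //; exact: cvg_bump_itv.
Qed.

Lemma test_function_box_bump (Om : set T) k (a b : T) :
  box (a, b) `<=` Om -> test_function Om (box_bump k a b).
Proof.
move=> abOm.
have sub : closure [set x | box_bump k a b x != 0] `<=` box (a, b).
  have /closure_id -> := @closed_box R n (a, b).
  by apply: closure_subset => x /= /box_bump_neq0; exact: open_box_sub.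
split; last exact: subset_trans abOm.
  by apply: smooth_prod_fun => i m; exact: Ck_bump_itv.
apply: subclosed_compact sub; first exact: closed_closure.
exact: compact_box.
Qed.

Lemma continuous_measurable_rV (g : T -> R) (D : set T) :
  measurable D -> continuous g -> measurable_fun D g.
Proof.
move=> mD cg; apply: (measurability _ (RGenOInfty.measurableE R)).
move=> _ [_ [a ->] <-]; apply: measurableI => //.
by apply: open_measurable_rV; apply: open_comp => //; exact: interval_open.
Qed.

Lemma compact_support_bounded (g : T -> R^o) (K : set T) :
  continuous g -> compact K -> (forall x, ~ K x -> g x = 0) ->
  exists2 C, 0 <= C & forall x, `|g x| <= C.
Proof.
move=> cg cK gK.
have cgK : compact (g @` K).
  by apply: continuous_compact => //; exact: continuous_subspaceT.
have [M [_ HM]] := compact_bounded cgK.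
exists (`|M| + 1) => [|x]; first by rewrite addr_ge0.
have [Kx|nKx] := pselect (K x); last by rewrite gK// normr0 addr_ge0.
apply: (HM (`|M| + 1)); first by rewrite ltr_pwDr// ler_norm.
by exists x.
Qed.

Lemma test_function_cont_supp (Om : set T) (phi : T -> R^o) :
  test_function Om phi ->
  let K := closure [set x | phi x != 0] in
  [/\ compact K, K `<=` Om,
      continuous phi /\ forall x, ~ K x -> phi x = 0 &
      forall j, continuous (partial j phi) /\
        forall x, ~ K x -> partial j phi x = 0].
Proof.
move=> [sphi cK KOm] K.
have phi0 x : ~ K x -> phi x = 0.
  by move=> nKx; apply/eqP; apply: contrapT => /negP px; apply: nKx; exact: subset_closure.
split=> //; first by split => //; have [] := sphi [::].
move=> j; split; first by have [] := sphi [:: j].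
move=> x nKx; rewrite /partial.
have : \near x, phi x = cst 0 x.
  have : open (~` K) by apply: closed_openC; exact: closed_closure.
  rewrite openE => /(_ x nKx); rewrite /interior; apply: filterS => y /=.
  exact: phi0.
by move=> /(near_eq_derive (delta_mx ord0 j)) ->; rewrite derive_cst.
Qed.

End smooth_several_variables.

(** * Strong measurability and integration *)

Section finitely_valued.
Context d (S : measurableType d).
Implicit Types (D : set S).

(* [simple_on] for functions with values in an arbitrary type. *)
Definition fin_meas (U : Type) D (s : S -> U) :=
  finite_set (s @` D) /\ forall v, measurable (D `&` s @^-1` [set v]).

Lemma fin_meas_preimage (U : Type) D (s : S -> U) (A : set U) :
  fin_meas D s -> measurable (D `&` s @^-1` A).
Proof.
move=> [fs ms]; rewrite (_ : D `&` _ =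
    \bigcup_(v in s @` D `&` A) (D `&` s @^-1` [set v])).
  by apply: fin_bigcup_measurable => //; exact: finite_setIl.
apply/seteqP; split=> [x [Dx Asx]|x [v [_ Av] [Dx sxv]]].
  by exists (s x) => //; split=> //; exists x.
by split=> //; rewrite /preimage /= sxv.
Qed.

Lemma fin_meas_comp (U W : Type) D (s : S -> U) (h : U -> W) :
  fin_meas D s -> fin_meas D (h \o s).
Proof.
move=> ss; split.
  by rewrite -image_comp; apply: finite_image; case: ss.
by move=> w; have := fin_meas_preimage (h @^-1` [set w]) ss.
Qed.

Lemma fin_meas_pair (U W : Type) D (s : S -> U) (t : S -> W) :
  fin_meas D s -> fin_meas D t -> fin_meas D (fun x => (s x, t x)).
Proof.
move=> [fs ms] [ft mt]; split.
  apply: (sub_finite_set _ (finite_setX fs ft)) => _ [x Dx <-].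
  by split; exists x.
move=> [v w]; rewrite (_ : D `&` _ =
    (D `&` s @^-1` [set v]) `&` (D `&` t @^-1` [set w])).
  exact: measurableI.
apply/seteqP; split=> x /=; first by move=> [Dx [-> ->]].
by move=> [[Dx ->] [_ ->]].
Qed.

Lemma fin_meas_bool D (b : S -> bool) : measurable (D `&` [set x | b x]) ->
  measurable D -> fin_meas D b.
Proof.
move=> mb mD; split; first exact: finite_finset.
move=> [|]; first exact: mb.
rewrite (_ : D `&` _ = D `\` (D `&` [set x | b x])); first exact: measurableD.
apply/seteqP; split=> x /=; first by move=> [Dx ->]; split=> // -[].
by move=> [Dx H]; split=> //; apply/negbTE/negP => bx; apply: H.
Qed.

Lemma fin_meas_measurable (R : realType) D (s : S -> R) :
  fin_meas D s -> measurable_fun D s.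
Proof. by move=> ss _ Y _; exact: fin_meas_preimage. Qed.

Lemma fin_measS (U : Type) D E (s : S -> U) : measurable E -> E `<=` D ->
  fin_meas D s -> fin_meas E s.
Proof.
move=> mE ED [fs ms]; split; first exact/(sub_finite_set _ fs)/image_subset.
move=> v; rewrite (_ : E `&` _ = E `&` (D `&` s @^-1` [set v])).
  exact: measurableI.
by rewrite setIA (setIidl ED).
Qed.

End finitely_valued.

Lemma cvg_EFinE (R : realType) (u : nat -> R) (l : R) :
  ((u k)%:E @[k --> \oo] --> l%:E)%E <-> u k @[k --> \oo] --> l.
Proof.
split=> [|ul]; first exact: fine_cvg.
by apply: cvg_EFin => //; exact: nearW.
Qed.

Section strongly_measurable.
Context d (S : measurableType d) (R : realType).
Context (mu : {measure set S -> \bar R}).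
Implicit Types (D : set S) (V W Z : completeNormedModType R).

Lemma strongly_measurable_comp2 V W Z D (u : S -> V) (v : S -> W)
    (h : V * W -> Z) : continuous h ->
  strongly_measurable mu D u -> strongly_measurable mu D v ->
  strongly_measurable mu D (fun x => h (u x, v x)).
Proof.
move=> ch [s [ss su]] [t [st tv]]; exists (fun k x => h (s k x, t k x)); split.
  by move=> k; exact: (fin_meas_comp h (fin_meas_pair (ss k) (st k))).
apply: filterS2 su tv => x sux tvx Dx.
apply: (@cvg_comp _ _ _ (fun k => (s k x, t k x)) h); last exact: ch.
by apply: cvg_pair; [exact: sux|exact: tvx].
Qed.

Lemma strongly_measurable_comp V W D (u : S -> V) (h : V -> W) :
  continuous h -> strongly_measurable mu D u ->
  strongly_measurable mu D (h \o u).
Proof.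
move=> ch [s [ss su]]; exists (fun k => h \o s k); split.
  by move=> k; exact: (fin_meas_comp h (ss k)).
apply: filterS su => x sux Dx.
by apply: (@cvg_comp _ _ _ (fun k => s k x) h); [exact: sux|exact: ch].
Qed.

Lemma strongly_measurableB V D (u v : S -> V) :
  strongly_measurable mu D u -> strongly_measurable mu D v ->
  strongly_measurable mu D (fun x => u x - v x).
Proof.
by apply: (@strongly_measurable_comp2 V V V D u v (fun p => p.1 - p.2)) => p;
  exact: sub_continuous.
Qed.

Lemma simple_strongly_measurable V D (s : S -> V) :
  simple_on D s -> strongly_measurable mu D s.
Proof.
by move=> ss; exists (fun=> s); split=> //; apply: aeW => x _; exact: cvg_cst.
Qed.

Lemma strongly_measurableS V D E (u : S -> V) : measurable E -> E `<=` D ->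
  strongly_measurable mu D u -> strongly_measurable mu E u.
Proof.
move=> mE ED [s [ss su]]; exists s; split=> [k|]; first exact: (fin_measS mE ED (ss k)).
by apply: filterS su => x + /ED; apply.
Qed.

Lemma measurable_strongly_measurable D (phi : S -> R) : measurable D ->
  measurable_fun D phi -> strongly_measurable mu D (phi : S -> R^o).
Proof.
move=> mD mphi; have [g gphi] := approximation_sfun mD
  ((measurable_EFinP _ _).2 mphi).
exists (fun k x => g k x); split=> [k|].
  split; last first.
    by move=> v; apply: measurableI => //; exact: measurable_funPTI.
  apply: (sub_finite_set _ (@fimfunP _ _ (g k))).
  by move=> _ [x _ <-]; exists x.
by apply: aeW => x Dx; apply/(cvg_EFinE (fun k => g k x)); exact: gphi.
Qed.

Lemma strongly_measurableZ V D (phi : S -> R) (u : S -> V) : measurable D ->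
  measurable_fun D phi -> strongly_measurable mu D u ->
  strongly_measurable mu D (fun x => phi x *: u x).
Proof.
move=> mD mphi; apply: (@strongly_measurable_comp2 R^o V V D phi u
  (fun p => p.1 *: p.2)); first by move=> p; exact: scale_continuous.
exact: measurable_strongly_measurable.
Qed.

Context (mu_complete : measure_is_complete mu).

(** The upper limit of the sequence is measurable and equals [f] almost everywhere; completeness of
    [mu] transfers measurability to [f]. *)
Lemma ae_measurable_cvg D (f_ : nat -> S -> R) (f : S -> R) : measurable D ->
  (forall k, measurable_fun D (f_ k)) ->
  (\forall x \ae mu, D x -> f_ k x @[k --> \oo] --> f x) -> measurable_fun D f.
Proof.
move=> mD mf ff; apply/measurable_EFinP.
apply: (@ae_measurable_fun _ _ _ _ mu_complete D
    (fun x => limn_esup (fun k => (f_ k x)%:E))).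
  apply: filterS ff => x fx Dx.
  have /cvg_limn_einf_sup[_ ->//] :
    ((f_ k x)%:E @[k --> \oo] --> (f x)%:E)%E by apply/cvg_EFinE; exact: fx.
by apply: measurable_fun_limn_esup => k; apply/measurable_EFinP.
Qed.

Lemma strongly_measurable_measurable V D (u : S -> V) (h : V -> R) :
  measurable D -> continuous h -> strongly_measurable mu D u ->
  measurable_fun D (h \o u).
Proof.
move=> mD ch [s [ss su]]; apply: (@ae_measurable_cvg D (fun k => h \o s k)) => //.
  by move=> k; apply/fin_meas_measurable/fin_meas_comp; exact: ss.
apply: filterS su => x sux Dx.
by apply: (@cvg_comp _ _ _ (fun k => s k x) h); [exact: sux|exact: ch].
Qed.

Lemma strongly_measurable_norm V D (u : S -> V) : measurable D ->
  strongly_measurable mu D u -> measurable_fun D (fun x => `|u x|).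
Proof.
move=> mD; apply: (strongly_measurable_measurable (h := fun v => `|v|)) => //.
exact: norm_continuous.
Qed.

(** The exceptional set in the hypothesis depends on [f], so only countably many functionals may be
    used: one norming each value of each simple approximant. When [s k x] is within [e / 2] of
    [w x], the functional norming [s k x] recovers the norm of [w x] up to [e]. *)
Lemma strongly_measurable_norming V D (w : S -> V) (g : S -> R) :
  strongly_measurable mu D w ->
  (forall f : {linear V -> R^o}, dual_unit_ball f ->
    \forall x \ae mu, D x -> `|f (w x)| <= g x) ->
  \forall x \ae mu, D x -> `|w x| <= g x.
Proof.
move=> [s [ss sw]] H.
have /choice[F FP] (v : V) : exists f : {linear V -> R^o},
    dual_unit_ball f /\ f v = `|v|.
  by have [f fb fv] := norming_functional v; exists f.
have /choice[r rE] k : exists r : seq V, s k @` D = [set` r].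
  by apply/finite_seqP; case: (ss k).
have Hk k : \forall x \ae mu, forall v, v \in r k -> D x -> `|F v (w x)| <= g x.
  elim: (r k) => [|v q IH]; first exact: aeW.
  apply: filterS2 (H _ (FP v).1) IH => x Hv IHx v'.
  by rewrite inE => /predU1P[->|/IHx].
have := ae_foralln Hk; apply: filterS2 sw => x swx Hx Dx.
apply/ler_addgt0Pr => e e0.
have /cvgrPdist_le /(_ (e / 2) ltac:(by rewrite divr_gt0))[k _ sk] := swx Dx.
have {}sk := sk k (leqnn k).
have rk : s k x \in r k by have : [set` r k] (s k x) by rewrite -rE; exists x.
have Hs := Hx k _ rk Dx.
have [Fb FE] := FP (s k x); have /dual_unit_ballP Fle := Fb.
have := Fle (w x - s k x); rewrite linearB/= FE => H1.
have H2 := ler_norm (F (s k x) (w x)).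
have H3 := ler_norm (- (F (s k x) (w x) - `|s k x|)); rewrite normrN in H3.
have := ler_normB (w x) (w x - s k x).
have := ler_normD (w x - s k x) (s k x); rewrite subrK.
by move: H1 H2 H3 sk Hs; set a := F _ _; lra.
Qed.

End strongly_measurable.

Lemma cauchy_bound_cvg (R : realType) (V : completeNormedModType R)
    (e : nat -> V) (a : nat -> R) :
  (forall k l, `|e k - e l| <= a k + a l) -> a k @[k --> \oo] --> (0 : R) ->
  cvg (e k @[k --> \oo]).
Proof.
move=> ea a0; apply: cauchy_cvg; apply: cauchy_exP => r r0.
have r20 : 0 < r / 2 by rewrite divr_gt0.
have /cvgrPdist_lt/(_ _ r20)[N _ aN] := a0.
exists (e N); exists N => // k /= Nk; rewrite -ball_normE /=.
apply: le_lt_trans (ea N k) _; rewrite (splitr r).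
have := aN N (leqnn N); have := aN k Nk; rewrite /= !sub0r !normrN => ak aN'.
by apply: ltrD; apply: le_lt_trans (ler_norm _) _.
Qed.

Lemma cvg_norm_le (R : realType) (v : nat -> R) (l c : R) :
  v k @[k --> \oo] --> l -> (forall k, `|v k| <= c) -> `|l| <= c.
Proof.
move=> vl vc; have nl : `|v k| @[k --> \oo] --> `|l| by exact: cvg_norm.
rewrite -(cvg_lim _ nl)//; apply: limr_le; last exact: nearW.
by apply/cvg_ex; exists `|l|.
Qed.

Lemma sum_indic_le1 (R : numDomainType) (U : Type) (F : (set U)^nat)
    (k : nat) (x : U) :
  trivIset `I_k F -> \sum_(i < k) \1_(F i) x <= 1 :> R.
Proof.
move=> tF; have [[m mk Fmx]|noF] := pselect (exists2 m, (m < k)%N & F m x).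
  rewrite (bigD1 (Ordinal mk))//= big1 => [|i im].
    by rewrite addr0 indicE lern1 leq_b1.
  rewrite indicE memNset// => Fix; move/eqP: im; apply; apply/val_inj.
  by apply: (tF i m) => //=; exists x.
rewrite big1// => i _; rewrite indicE memNset// => Fix; apply: noF.
by exists i.
Qed.

Section integration.
Context d (S : measurableType d) (R : realType).
Context (mu : {measure set S -> \bar R}) (D : set S) (mD : measurable D).

Lemma Rintegral_dominated_cvg (F : nat -> S -> R) (f G : S -> R) :
  (forall k, measurable_fun D (F k)) -> measurable_fun D f ->
  mu.-integrable D (EFin \o G) ->
  (\forall x \ae mu, forall k, D x -> `|F k x| <= G x) ->
  (\forall x \ae mu, D x -> F k x @[k --> \oo] --> f x) ->
  \int[mu]_(x in D) F k x @[k --> \oo] --> \int[mu]_(x in D) f x.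
Proof.
move=> mF mf iG FG Ff.
have [] := @dominated_convergence _ _ _ mu D mD
    (fun k x => (F k x)%:E) (EFin \o f) (EFin \o G).
- by move=> k; exact/measurable_EFinP.
- exact/measurable_EFinP.
- by apply: filterS Ff => x Fx Dx; apply/cvg_EFinE; exact: Fx.
- exact: iG.
- by apply: filterS FG => x FG k Dx; rewrite lee_fin FG.
- move=> if_ _ H; apply: fine_cvg; rewrite fineK//.
  exact: integrable_fin_num.
Qed.

Lemma Rintegral_indic (k : S -> R) (E : set S) : E `<=` D ->
  \int[mu]_(x in D) (k x * \1_E x) = \int[mu]_(x in E) k x.
Proof.
move=> ED; rewrite -[in RHS](setIidr ED) Rintegral_mkcondr.
apply: eq_Rintegral => x _; rewrite /patch indicE.
by case: (boolP (x \in E)); rewrite ?mulr1 ?mulr0.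
Qed.

Lemma ae_le_integrable (a b : S -> R) : measurable_fun D a ->
  mu.-integrable D (EFin \o b) ->
  (\forall x \ae mu, D x -> `|a x| <= `|b x|) ->
  mu.-integrable D (EFin \o a).
Proof.
move=> ma ib ab; have /integrableP[mb ibn] := ib.
have mEa : measurable_fun D (EFin \o a) by exact/measurable_EFinP.
apply/integrableP; split=> //; apply: le_lt_trans ibn.
apply: (ae_ge0_le_integral mD).
- by move=> x _; exact: abse_ge0.
- exact: measurableT_comp.
- by move=> x _; exact: abse_ge0.
- exact: measurableT_comp.
- by apply: filterS ab => x H Dx; rewrite /= lee_fin H.
Qed.

Lemma measurable_funV (rho : S -> R) : measurable_fun D rho ->
  (forall x, D x -> 0 < rho x) -> measurable_fun D (fun x => (rho x)^-1).
Proof.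
move=> mrho rho0; apply: (eq_measurable_fun (fun x => rho x `^ (-1))).
  by move=> x /[!inE] Dx; rewrite powR_inv1// ltW// rho0.
exact: (measurableT_comp (measurable_powR _) mrho).
Qed.

End integration.

(** * The Bochner integral through functionals *)

Section bochner.
Context d (S : measurableType d) (R : realType).
Context (mu : {measure set S -> \bar R}) (D : set S) (mD : measurable D).
Context (V : completeNormedModType R).
Implicit Types (f : {linear V -> R^o}) (u s : S -> V).

Lemma dist_Rintegral (a b : S -> R) :
  mu.-integrable D (EFin \o a) -> mu.-integrable D (EFin \o b) ->
  (`|\int[mu]_(x in D) a x - \int[mu]_(x in D) b x|%:E <=
   \int[mu]_(x in D) `|a x - b x|%:E)%E.
Proof.
move=> ia ib; rewrite -RintegralB//.
have iab : mu.-integrable D (EFin \o (fun x => a x - b x)).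
  by rewrite /comp; under eq_fun do rewrite EFinB; exact: integrableB.
rewrite EFin_normr_Rintegral//.
by have /measurable_int mab := iab; exact: (le_abse_integral mu mD mab).
Qed.

Lemma simple_integral_dual s f : dual_unit_ball f -> integrable_simple_on mu D s ->
  mu.-integrable D (EFin \o (f \o s)) /\
  f (simple_integral mu D s) = \int[mu]_(x in D) f (s x).
Proof.
move=> fb [[fs ms] is_].
have /finite_seqP[r0 r0E] := fs.
pose r := undup r0; have ur : uniq r by exact: undup_uniq.
have rE : s @` D = [set` r] by rewrite r0E; apply/seteqP; split=> v /=; rewrite mem_undup.
pose A v := D `&` s @^-1` [set v].
have E x : D x -> (f (s x))%:E = (\sum_(v <- r) (f v * \1_(A v) x)%:E)%E.
  move=> Dx; rewrite sumEFin; congr (_%:E).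
  have sr : s x \in r by have : [set` r] (s x) by rewrite -rE; exists x.
  rewrite (bigD1_seq (s x))//= big1 ?addr0 => [|v vs].
    by rewrite indicE mem_set ?mulr1//; split.
  rewrite indicE memNset ?mulr0// => -[_] /= sv.
  by move: vs; rewrite -sv eqxx.
have I v : mu.-integrable D (fun x => (f v * \1_(A v) x)%:E) /\
    (\int[mu]_(x in D) (f v * \1_(A v) x)%:E = (f v * fine (mu (A v)))%:E)%E.
  (* Only the level set of 0 may have infinite measure, and its term vanishes because [f 0 = 0]. *)
  have [->|v0] := eqVneq v 0.
    rewrite linear0; under eq_fun do rewrite mul0r; split; first exact: integrable0.
    by rewrite integral0 mul0r.
  have Afin := is_ _ v0.
  have iA : mu.-integrable D (fun x => (\1_(A v) x)%:E).
    apply/integrableP; split; first exact/measurable_EFinP/measurable_indic/ms.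
    under eq_integral do rewrite /= ger0_norm//.
    rewrite integral_indic//; last exact: ms.
    by rewrite (setIidl (@subIsetl _ _ _)).
  split; first by under eq_fun do rewrite EFinM; exact: integrableZl.
  under eq_integral do rewrite EFinM.
  rewrite integralZl// integral_indic//; last exact: ms.
  rewrite (setIidl (@subIsetl _ _ _)) EFinM fineK// ge0_fin_numE//.
split.
  apply: (eq_integrable mD (fun x => (\sum_(v <- r) (f v * \1_(A v) x)%:E)%E)).
    by move=> x; rewrite inE => /E /= ->.
  by apply: integrable_sum => // v _; have [] := I v.
rewrite /Rintegral /simple_integral rE.
have -> : (\int[mu]_(x in D) (f (s x))%:E =
    \sum_(v <- r) (f v * fine (mu (A v)))%:E)%E.
  under eq_integral => x /[!inE] Dx do rewrite (E x Dx).
  rewrite integral_sum//; last by move=> v; have [] := I v.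
  by apply: eq_bigr => v _; have [] := I v.
rewrite sumEFin -fsbig_seq//= linear_sum; apply: eq_bigr => v _.
by rewrite linearZ mulrC.
Qed.

Context (mu_complete : measure_is_complete mu).

(** The identity holds for integrable simple functions, and both sides pass to the limit: the left
    one by continuity of [f], the right one because [f] does not increase norms. *)
Lemma is_bochner_integral_dual u w f : dual_unit_ball f ->
  is_bochner_integral mu D u w ->
  mu.-integrable D (EFin \o (f \o u)) /\ f w = \int[mu]_(x in D) f (u x).
Proof.
move=> fb [su [s [ss us sw]]]; have [cf _] := fb.
have /dual_unit_ballP fle := fb.
have mfu : measurable_fun D (f \o u).
  exact: (strongly_measurable_measurable mu_complete mD cf su).
have mus k : measurable_fun D (fun x => `|u x - s k x|).
  apply: (strongly_measurable_norm mu_complete mD); apply: strongly_measurableB => //.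
  by apply: simple_strongly_measurable; case: (ss k).
have H k x : `|f (u x) - f (s k x)| <= `|u x - s k x| by rewrite -linearB fle.
have [ifs fsE] : (forall k, mu.-integrable D (EFin \o (f \o s k))) /\
    forall k, f (simple_integral mu D (s k)) = \int[mu]_(x in D) f (s k x).
  by split=> k; have [] := simple_integral_dual fb (ss k).
have ifu : mu.-integrable D (EFin \o (f \o u)).
  (* Integrals that tend to 0 are eventually finite, and a single such [s k] suffices to dominate
     [f \o u]. *)
  have [k Hk] : exists k, (\int[mu]_(x in D) `|u x - s k x|%:E < +oo)%E.
    have /fine_cvgP[[k _ Hk] _] := us; exists k.
    by have := Hk k (leqnn k); rewrite ge0_fin_numE// integral_ge0.
  apply: (le_integrable mD (g := fun x => (`|u x - s k x| + `|f (s k x)|)%:E)).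
  - exact/measurable_EFinP.
  - move=> x Dx; rewrite lee_fin [leRHS]ger0_norm ?addr_ge0//=.
    rewrite -[f (u x)](subrK (f (s k x))) (le_trans (ler_normD _ _))//.
    by rewrite lerD2r.
  - under eq_fun do rewrite EFinD; apply: integrableD => //.
      apply/integrableP; split; first exact/measurable_EFinP.
      by under eq_integral do rewrite /= normr_id.
    exact: (integrable_abse (ifs k)).
split=> //.
have : f (simple_integral mu D (s k)) @[k --> \oo] --> (\int[mu]_(x in D) f (u x) : R^o).
  have /fine_cvgP[fin us0] := us.
  apply/cvgrPdist_le => e e0; have /cvgrPdist_le/(_ e e0) := us0.
  apply: filterS2 fin => k fk /=; rewrite sub0r normrN => ke.
  rewrite fsE -lee_fin; apply: le_trans (dist_Rintegral ifu (ifs k)) _.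
  apply: (@le_trans _ _ (\int[mu]_(x in D) `|u x - s k x|%:E)%E).
    apply: ge0_le_integral => //.
    - apply/measurable_EFinP; apply: measurableT_comp => //.
      apply: measurable_funB => //; apply/measurable_EFinP.
      exact: measurable_int (ifs k).
    - exact/measurable_EFinP.
    - by move=> x Dx; rewrite lee_fin; exact: H.
  by rewrite -(fineK fk) lee_fin (le_trans (ler_norm _) ke).
move=> H1.
have H2 : f (simple_integral mu D (s k)) @[k --> \oo] --> f w.
  by apply: (@cvg_comp _ _ _ _ f _ _ _ sw); exact: cf.
exact: (cvg_unique _ H2 H1).
Qed.

(** Simple approximants given by strong measurability need not be integrable nor dominated, so they
    are truncated relative to the norm of [u]; dominated convergence then gives convergence in mean,
    and completeness of [V] the limit of their integrals. *)
Lemma exists_bochner_integral u : L1 mu D u -> exists w, is_bochner_integral mu D u w.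
Proof.
move=> [su uoo]; have [s [ss us]] := su.
have mnu : measurable_fun D (fun x => `|u x|).
  exact: (strongly_measurable_norm mu_complete mD su).
(* The bound 2, strictly above 1, keeps [s k x] for large [k] wherever [u x] is nonzero; where
   [u x = 0] the truncation is 0. The error is at most three times the norm of [u], and a nonzero
   value is only taken where [u] is bounded away from 0. *)
pose t k x := if `|s k x| <= 2 * `|u x| then s k x else 0.
have st k : simple_on D (t k).
  apply: (fin_meas_comp (fun p : V * bool => if p.2 then p.1 else 0)
    (s := fun x => (s k x, `|s k x| <= 2 * `|u x|))).
  apply: fin_meas_pair; first exact: ss.
  apply: fin_meas_bool => //.
  have : measurable_fun D (fun x => `|s k x| <= 2 * `|u x|).
    apply: measurable_fun_ler; last exact: measurable_funM.
    apply: (fin_meas_measurable (s := fun x => `|s k x|)).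
    exact: (fin_meas_comp (fun v => `|v|) (ss k)).
  by move=> /(_ mD [set true] Logic.I).
have ut : \forall x \ae mu, D x -> t k x @[k --> \oo] --> u x.
  apply: filterS us => x sux Dx; have {}sux := sux Dx.
  have [ux0|ux0] := eqVneq (u x) 0.
    suff -> : (fun k => t k x) = (fun=> 0) by rewrite ux0; exact: cvg_cst.
    apply/funext => k; rewrite /t ux0 normr0 mulr0.
    by case: ifPn => //; rewrite normr_le0 => /eqP.
  have ns : `|s k x| @[k --> \oo] --> `|u x| by exact: cvg_norm.
  apply: cvg_trans sux; apply: near_eq_cvg.
  have : `|u x| < 2 * `|u x| by rewrite ltr_pMl ?normr_gt0// ltr1n.
  move=> /(cvgr_lt _ ns); apply: filterS => k /ltW sk.
  by rewrite /t sk.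
have tu k x : `|u x - t k x| <= 3 * `|u x|.
  rewrite /t; case: ifPn => [sk|_]; last by rewrite subr0 ler_peMl// ler1n.
  by apply: le_trans (ler_normB _ _) _; move: sk; lra.
have smt k : strongly_measurable mu D (fun x => u x - t k x).
  apply: strongly_measurableB => //.
  exact: simple_strongly_measurable.
have mut k : measurable_fun D (fun x => `|u x - t k x|).
  exact: (strongly_measurable_norm mu_complete mD).
have iu : mu.-integrable D (fun x => `|u x|%:E).
  apply/integrableP; split; first exact/measurable_EFinP.
  by under eq_integral do rewrite /= normr_id.
have i3u : mu.-integrable D (fun x => (3 * `|u x|)%:E).
  by under eq_fun do rewrite EFinM; exact: integrableZl.
have lim : (\int[mu]_(x in D) `|u x - t k x|%:E)%E @[k --> \oo] --> 0%E.
  have [] := @dominated_convergence _ _ _ mu D mD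
    (fun k x => `|u x - t k x|%:E) (fun=> 0%E) (fun x => (3 * `|u x|)%:E).
  - by move=> k; exact/measurable_EFinP.
  - exact: measurable_cst.
  - apply: filterS ut => x tux Dx; apply/cvg_EFinE.
    rewrite -(@normr0 _ V) -(subrr (u x)).
    by apply: cvg_norm; apply: cvgB; [exact: cvg_cst|exact: tux].
  - exact: i3u.
  - by apply: aeW => x k Dx; rewrite /= normr_id lee_fin.
  - by move=> _ _; rewrite integral0.
have it k : integrable_simple_on mu D (t k).
  split; first exact: st.
  move=> v v0; set E := D `&` _.
  have mE : measurable E by exact: (st k).2.
  have nv : 0 < `|v| by rewrite normr_gt0.
  have : (\int[mu]_(x in E) `|v|%:E < +oo)%E.
    apply: (@le_lt_trans _ _ (\int[mu]_(x in D) (3 * `|u x|)%:E)%E); last first.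
      exact: integrable_lty i3u.
    apply: (@le_trans _ _ (\int[mu]_(x in E) (3 * `|u x|)%:E)%E).
      apply: ge0_le_integral => //.
      - by apply: measurable_funS (measurable_int _ i3u) => // x [].
      - move=> x [Dx /=]; rewrite /t lee_fin; case: ifPn => [sk sv|_ v0'].
          by move: sk; rewrite sv; have := normr_ge0 (u x); lra.
        by move: v0; rewrite -v0' eqxx.
    by apply: ge0_subset_integral => //; [exact: measurable_int i3u|move=> x []].
  rewrite integral_cst//; have := measure_ge0 mu E.
  case: (mu E) => [r _ _|_|//]; first exact: ltry.
  by rewrite gt0_muley.
have [w tw] : exists w : V, simple_integral mu D (t k) @[k --> \oo] --> w.
  pose a k := fine (\int[mu]_(x in D) `|u x - t k x|%:E)%E.
  have aE k : (\int[mu]_(x in D) `|u x - t k x|%:E = (a k)%:E)%E.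
    rewrite fineK// ge0_fin_numE ?integral_ge0//.
    apply: le_lt_trans (integrable_lty mD i3u).
    apply: ge0_le_integral => //; first exact/measurable_EFinP.
      exact: measurable_int i3u.
    by move=> x Dx; rewrite lee_fin.
  have : cvg (simple_integral mu D (t k) @[k --> \oo]).
    apply: (@cauchy_bound_cvg _ _ _ a); last exact: fine_cvg lim.
    (* A functional norming the difference of the two integrals reduces the Cauchy estimate to real
       integrals and the triangle inequality through [u]. *)
    move=> k l; have [f fb <-] :=
      norming_functional (simple_integral mu D (t k) - simple_integral mu D (t l)).
    have [ik fk] := simple_integral_dual fb (it k).
    have [il fl] := simple_integral_dual fb (it l).
    have /dual_unit_ballP fle := fb.
    rewrite linearB/= fk fl; apply: le_trans (ler_norm _) _.
    rewrite -lee_fin; apply: le_trans (dist_Rintegral ik il) _.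
    rewrite EFinD -!aE -ge0_integralD//; last 2 first.
      exact/measurable_EFinP.
      exact/measurable_EFinP.
    apply: ge0_le_integral => //.
    - apply/measurable_EFinP; apply: measurableT_comp => //.
      by apply: measurable_funB; apply/measurable_EFinP;
        [exact: measurable_int ik|exact: measurable_int il].
    - by apply: emeasurable_funD; exact/measurable_EFinP.
    - move=> x Dx; rewrite -EFinD lee_fin -linearB; apply: le_trans (fle _) _.
      by rewrite distrC [leRHS]addrC -(subrKA (u x)) [X in _ <= X + _]distrC ler_normD.
  by move=> /cvg_ex[w]; exists w.
by exists w; split=> //; exists t.
Qed.

Lemma bochner_integral_dual u f : dual_unit_ball f -> L1 mu D u ->
  mu.-integrable D (EFin \o (f \o u)) /\
  f (bochner_integral mu D u) = \int[mu]_(x in D) f (u x).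
Proof.
move=> fb /exists_bochner_integral[w uw].
exact: is_bochner_integral_dual fb (xgetPex 0 (ex_intro _ w uw)).
Qed.


End bochner.

(** The identity of [R^o] lies in the dual unit ball, so this is an instance of
    [bochner_integral_dual]. *)
Lemma bochner_integral_real d (S : measurableType d) (R : realType)
    (mu : {measure set S -> \bar R}) (D : set S) (u : S -> R^o) :
  measurable D -> measure_is_complete mu -> L1 mu D u ->
  mu.-integrable D (EFin \o u) /\
  bochner_integral mu D u = \int[mu]_(x in D) u x.
Proof.
move=> mD muC uL1.
have idb : dual_unit_ball (idfun : {linear R^o -> R^o}) by apply/dual_unit_ballP.
exact: bochner_integral_dual idb uL1.
Qed.

(** * Density of test functions *)

Lemma indic_setD (R : nzRingType) (U : Type) (A B : set U) (x : U) : A `<=` B ->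
  \1_(B `\` A) x = \1_B x - \1_A x :> R.
Proof.
move=> AB; rewrite !indicE in_setD; case: (boolP (x \in A)) => xA.
  by have -> : x \in B; [move: xA; rewrite !inE => /AB|rewrite subrr].
by rewrite andbT subr0.
Qed.

Section density.
Context {R : realType} {n : nat}.
Local Notation T := 'rV[R]_n.+1.
Local Notation leb := (@lebesgue_rV R n).
Context (Om : set T) (oOm : open Om) (g : T -> R).
Context (mg : measurable_fun Om g) (g0 : forall x, Om x -> 0 <= g x).
Context (gK : forall K, compact K -> K `<=` Om ->
  (\int[leb]_(x in K) (g x)%:E < +oo)%E).
Implicit Types (h : T -> R) (A B : set T) (P : (T -> R) -> Prop).

Let mOm : measurable Om. Proof. exact: open_measurable_rV. Qed.

Definition weight_integrable h :=
  measurable_fun Om h /\ leb.-integrable Om (fun x => (h x * g x)%:E).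

Lemma weight_integrable_le h H : measurable_fun Om h -> weight_integrable H ->
  (forall x, Om x -> `|h x| <= H x) -> weight_integrable h.
Proof.
move=> mh [mH iH] hH; split=> //; apply: (le_integrable mOm) iH.
  by apply/measurable_EFinP; exact: measurable_funM.
move=> x Ox; rewrite lee_fin !normrM ler_wpM2r//.
exact: le_trans (hH x Ox) (ler_norm _).
Qed.

Lemma weight_integrable_lin (a b : R) h1 h2 :
  weight_integrable h1 -> weight_integrable h2 ->
  weight_integrable (fun x => a * h1 x + b * h2 x).
Proof.
move=> [mh1 ih1] [mh2 ih2]; split.
  by apply: measurable_funD; apply: measurable_funM.
rewrite (_ : (fun x => _) = (fun x => (a%:E * (h1 x * g x)%:E + b%:E * (h2 x * g x)%:E)%E)).
  by apply: integrableD => //; exact: integrableZl.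
by apply/funext => x; rewrite -!EFinM -EFinD mulrDl !mulrA.
Qed.

Lemma weight_integrable_indic K A : compact K -> K `<=` Om -> measurable A ->
  A `<=` K -> weight_integrable \1_A.
Proof.
move=> cK KOm mA AK; have [mK _] := compact_lebesgue_lty cK.
apply: (@weight_integrable_le _ \1_K) => [||x _].
- exact: measurable_indic.
- split; first exact: measurable_indic.
  apply/integrableP; split.
    by apply/measurable_EFinP; apply: measurable_funM => //; exact: measurable_indic.
  rewrite (_ : (\int[_]_(x in _) _ = \int[leb]_(x in K) (g x)%:E)%E); first exact: gK.
  rewrite -[in RHS](setIidr KOm) integral_mkcondr; apply: eq_integral => x /[!inE] Ox.
  rewrite /patch indicE; case: (boolP (x \in K)) => xK; last by rewrite mul0r /= normr0.
  by rewrite mul1r /= ger0_norm// g0.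
- rewrite !indicE ger0_norm//; case: (boolP (x \in A)) => //; rewrite ?ler0n// inE.
  by move=> /AK xK; rewrite mem_set.
Qed.

(** A closure principle stated for an arbitrary property because it serves twice: for the vanishing
    of the integral of [h] against a function, and for the existence of a vector [e] with
    [dual_mean h e]. *)
Definition dominated_closed P :=
  [/\ forall phi, test_function Om phi -> P phi,
      forall a b h1 h2, weight_integrable h1 -> weight_integrable h2 ->
        P h1 -> P h2 -> P (fun x => a * h1 x + b * h2 x) &
      forall (h_ : nat -> T -> R) h H, weight_integrable H ->
        (forall k, measurable_fun Om (h_ k)) -> measurable_fun Om h ->
        (forall k x, Om x -> `|h_ k x| <= H x) ->
        (\forall x \ae leb, Om x -> h_ k x @[k --> \oo] --> h x) ->
        (forall k, P (h_ k)) -> P h].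

Lemma dominated_closed_open_box P (a b : T) : dominated_closed P ->
  box (a, b) `<=` Om -> P \1_(open_box a b).
Proof.
move=> [Pt _ Pd] abOm.
apply: (Pd (fun k => box_bump k a b) _ \1_(box (a, b))).
- apply: (weight_integrable_indic (@compact_box _ _ (a, b))) => //.
  exact: measurable_box.
- move=> k; apply: continuous_measurable_rV => //.
  have [sphi _ _] := test_function_box_bump k abOm.
  by have [] := sphi [::].
- by apply: measurable_indic; exact: measurable_open_box.
- move=> k x _; have /andP[b0 b1] := box_bump_itv k a b x; rewrite ger0_norm// indicE.
  have [xab|xab] := boolP (x \in box (a, b)); first by [].
  rewrite leNgt lt0r b0 andbT; apply: contraNN xab => /box_bump_neq0 /open_box_sub.
  by rewrite inE.
- by apply: aeW => x _; exact: cvg_box_bump.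
- by move=> k; apply: Pt; exact: test_function_box_bump.
Qed.

Lemma dominated_closed_sub_box P (a b : T) : dominated_closed P ->
  box (a, b) `<=` Om ->
  forall A, measurable A -> A `<=` open_box a b -> P \1_A.
Proof.
move=> DP abOm; have [Pt Pl Pd] := DP.
set Q := open_box a b.
have mQ : measurable Q by exact: measurable_open_box.
have QK : Q `<=` box (a, b) by exact: open_box_sub.
have wi A : measurable A -> A `<=` Q -> weight_integrable \1_A.
  move=> mA AQ; apply: (weight_integrable_indic (@compact_box _ _ (a, b))) => //.
  exact: subset_trans QK.
apply: (@lebesgue_dynkin _ _ Q (fun A => P \1_A)) => //.
- apply: le_lt_trans (lebesgue_box_lty a b).
  exact: le_lebesgue_outer_rV.
- exact: dominated_closed_open_box.
- move=> c d.
  pose a' : T := \row_i Num.max (c ord0 i) (a ord0 i).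
  pose b' : T := \row_i Num.min (d ord0 i) (b ord0 i).
  rewrite (_ : _ `&` _ = open_box a' b').
    apply: dominated_closed_open_box => //; apply: subset_trans abOm => x H i.
    have /andP[] := H i; rewrite /= !mxE ge_max le_min.
    by move=> /andP[_ ->] /andP[_ ->].
  apply/seteqP; split=> x.
    move=> [H1 H2] i; have := H1 i; have := H2 i; rewrite !mxE gt_max lt_min.
    by move=> /andP[-> ->] /andP[-> ->].
  by move=> H; split=> i; have := H i; rewrite !mxE gt_max lt_min;
    move=> /andP[/andP[h1 h2] /andP[h3 h4]]; rewrite ?h1 ?h2 ?h3 ?h4.
- move=> A B mA mB AB BQ PA PB.
  rewrite (_ : \1_(B `\` A) = (fun x => 1 * \1_B x + (-1) * \1_A x)).
    by apply: Pl => //; apply: wi => //; exact: subset_trans BQ.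
  by apply/funext => x; rewrite mul1r mulN1r indic_setD.
- move=> F mF tF FQ PF.
  have FkQ k : \big[setU/set0]_(i < k) F i `<=` Q.
    by rewrite -bigcup_mkord => x [i _]; exact: FQ.
  have mFk k : measurable (\big[setU/set0]_(i < k) F i) by exact: bigsetU_measurable.
  apply: (Pd (fun k => \1_(\big[setU/set0]_(i < k) F i)) _ \1_Q).
  + exact: wi.
  + by move=> k; exact: measurable_indic.
  + by apply: measurable_indic; exact: bigcupT_measurable.
  + move=> k x _; rewrite !indicE ger0_norm//.
    by case: (boolP (x \in \big[_/_]_(_ < _) _)) => //;
      rewrite ?ler0n// inE => /FkQ xQ; rewrite mem_set.
  + apply: aeW => x _; rewrite indicE; case: (boolP (x \in \bigcup_k F k)) => xF.
      move: xF; rewrite inE => -[m _ Fmx].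
      apply: cvg_near_cst; exists m.+1 => // k /= mk.
      by rewrite indicE mem_set// -bigcup_mkord; exists m.
    apply: cvg_near_cst; apply: nearW => k; rewrite indicE memNset//.
    move: xF; rewrite notin_setE => xF; rewrite -bigcup_mkord => -[m _ Fmx].
    by apply: xF; exists m.
  + elim=> [|k IH].
      (* The zero function is reached as a trivial combination of [\1_Q]. *)
      rewrite big_ord0 (_ : \1_set0 = (fun x => 0 * \1_Q x + 0 * \1_Q x)).
        apply: Pl; [exact: wi|exact: wi| |];
          exact: dominated_closed_open_box.
      by apply/funext => x; rewrite !mul0r addr0 indicE in_set0.
    rewrite big_ord_recr/= (_ : \1_(_ `|` _) =
        (fun x => 1 * \1_(\big[setU/set0]_(i < k) F i) x + 1 * \1_(F k) x)).
      by apply: Pl => //; exact: wi.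
    apply/funext => x; rewrite !mul1r !indicE in_setU.
    case: (boolP (x \in F k)) => [|xFk]; last by rewrite orbF addr0.
    rewrite inE => Fkx; rewrite orbT memNset ?add0r//.
    rewrite -bigcup_mkord => -[m /= mk Fmx].
    have := tF m k I I (ex_intro _ x (conj Fmx Fkx)) => mkE.
    by rewrite mkE ltnn in mk.
- move=> A B mA mB AB BQ BA0 PB.
  (* The constant sequence [\1_B] converges to [\1_A] off the null set. *)
  apply: (Pd (fun=> \1_B) _ \1_B) => //.
  + exact: wi.
  + by move=> _ x _; rewrite indicE ger0_norm.
  + exists (B `\` A); split=> //; first exact: measurableD.
    move=> x /not_implyP[_ H]; apply: contrapT => xBA; apply: H.
    apply: cvg_near_cst; apply: nearW => _; rewrite !indicE.
    have [xA|xA] := boolP (x \in A).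
      by have -> : x \in B by move: xA; rewrite !inE => /AB.
    rewrite memNset// => Bx; apply: xBA; split=> //.
    by move: xA; rewrite notin_setE.
Qed.

(* The weight takes a constant value, small with respect to the integral of
   [g], on each piece of a partition of [Om] subordinate to boxes. *)
Lemma exists_density_weight : exists rho : T -> R,
  [/\ forall x, Om x -> 0 < rho x, weight_integrable rho &
      forall P, dominated_closed P -> forall A, measurable A ->
        P (fun x => rho x * \1_A x)].
Proof.
have [F [FOm OmE]] := open_box_cover oOm.
pose Q k := open_box (F k).1 (F k).2; pose D := seqDU Q.
have DQ k : D k `<=` Q k by exact: subset_seqDU.
have mD k : measurable (D k).
  by apply: seqDU_measurable => i; exact: measurable_open_box.
have tD : trivIset setT D by exact: trivIset_seqDU.
have OmD : Om = \bigcup_k D k by rewrite OmE; exact: seqDU_bigcup_eq.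
have DOm k : D k `<=` Om by rewrite OmD; exact: bigcup_sup.
have boxE k : box (F k) = box ((F k).1, (F k).2) by rewrite -surjective_pairing.
have DK k : D k `<=` box (F k).
  by rewrite boxE; exact: subset_trans (@DQ k) (@open_box_sub _ _ _ _).
have gD k : (\int[leb]_(x in D k) (g x)%:E < +oo)%E.
  have cK := @compact_box R n (F k).
  apply: le_lt_trans (gK cK (FOm k)).
  apply: (ge0_subset_integral leb (mD k) (measurable_box (F k))).
  - by apply/measurable_EFinP; exact: (measurable_funS mOm (FOm k) mg).
  - by move=> x /FOm Ox; rewrite lee_fin g0.
  - exact: DK.
have gDge0 k : (0 <= \int[leb]_(x in D k) (g x)%:E)%E.
  by apply: integral_ge0 => x /DOm Ox; rewrite lee_fin g0.
pose I k := fine (\int[leb]_(x in D k) (g x)%:E)%E.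
have I0 k : 0 <= I k by exact: fine_ge0.
have I1 k : 0 < 1 + I k by rewrite ltr_pwDl.
(* Chosen so that [c k * I k <= 1 / 2 ^ (k + 1)], which bounds the integral of [rho * g] by 1;
   adding 1 to [I k] keeps the denominator positive. *)
pose c k : R := (2 ^ k.+1)%:R^-1 / (1 + I k).
have c0 k : 0 < c k by rewrite divr_gt0// invr_gt0 ltr0n expn_gt0.
pose r N x := \sum_(k < N) c k * \1_(D k) x : R.
have rE N m x : D m x -> r N x = if (m < N)%N then c m else 0.
  move=> Dmx; have other k : k != m -> c k * \1_(D k) x = 0 :> R.
    move=> km; rewrite indicE memNset ?mulr0// => Dkx.
    by move/eqP: km; apply; apply: tD => //; exists x.
  rewrite /r; case: ifPn => [mN|]; last first.
    rewrite -leqNgt => Nm; apply: big1 => k _; apply: other.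
    by rewrite neq_ltn (leq_trans (ltn_ord k) Nm).
  rewrite (bigD1 (Ordinal mN))//= big1 => [|k km]; last exact: other.
  by rewrite addr0 indicE mem_set// mulr1.
(* At a point of [D m] the partial sums are stationary, equal to [c m] as soon as [N > m]. *)
pose rho x := limn (fun N => r N x).
have r_rho x : Om x -> r N x @[N --> \oo] --> rho x.
  rewrite {1}OmD => -[m _ Dmx].
  have rc : r N x @[N --> \oo] --> c m.
    by apply: cvg_near_cst; exists m.+1 => // N /= mN; rewrite (rE N m)// mN.
  by rewrite /rho (cvg_lim _ rc).
have rhoE m x : D m x -> rho x = c m.
  move=> Dmx; apply: cvg_lim => //.
  by apply: cvg_near_cst; exists m.+1 => // N /= mN; rewrite (rE N m)// mN.
have r0 N x : 0 <= r N x.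
  by apply: sumr_ge0 => k _; rewrite mulr_ge0 ?(ltW (c0 _))// indicE.
have rle N x : Om x -> r N x <= rho x.
  rewrite {1}OmD => -[m _ Dmx]; rewrite (rE N m)// (rhoE m)//.
  by case: ifP => // _; exact: ltW.
have rho0 x : Om x -> 0 < rho x.
  by rewrite {1}OmD => -[m _ Dmx]; rewrite (rhoE m).
have mr N : measurable_fun Om (r N).
  by apply: measurable_sum => k; apply: measurable_funM => //; exact: measurable_indic.
have mrho : measurable_fun Om rho by exact: measurable_fun_cvg mr r_rho.
have wrho : weight_integrable rho.
  split=> //; apply/integrableP; split.
    by apply/measurable_EFinP; exact: measurable_funM.
  have mf : measurable_fun Om (fun x => `|(rho x * g x)%:E|%E).
    apply: measurableT_comp; first exact: abse_measurable.
    by apply/measurable_EFinP; exact: measurable_funM.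
  have -> : (\int[leb]_(x in Om) `|(rho x * g x)%:E| =
      \sum_(k <oo) \int[leb]_(x in D k) `|(rho x * g x)%:E|)%E.
    rewrite {1}OmD; apply: (@ge0_integral_bigcup _ _ _ leb D _ mD _ _ tD).
      by rewrite -OmD.
    by move=> x _; exact: abse_ge0.
  apply: le_lt_trans (ltry 1).
  apply: le_trans (@epsilon_trick0 R 1 xpredT ler01).
  apply: lee_nneseries => [k _ _|k _]; first exact: integral_ge0.
  rewrite (_ : (\int[_]_(x in _) _ = \int[leb]_(x in D k) ((c k)%:E * (g x)%:E))%E).
    rewrite (ge0_integralZl_EFin leb (mD k)); last 3 first.
    - by move=> x /DOm Ox; rewrite lee_fin g0.
    - by apply/measurable_EFinP; exact: (measurable_funS mOm (DOm k) mg).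
    - exact: ltW.
    have -> : (\int[leb]_(x in D k) (g x)%:E = (I k)%:E)%E.
      by rewrite fineK// ge0_fin_numE.
    rewrite -EFinM lee_fin /c mul1r -mulrA ler_piMr ?invr_ge0//.
    by rewrite ler_pdivrMl// mulr1 lerDr.
  apply: eq_integral => x /[!inE] Dx; rewrite /= (rhoE k)// ger0_norm//.
  by rewrite mulr_ge0// ?(ltW (c0 _))// g0//; exact: DOm Dx.
exists rho; split=> // P DP A mA; have [_ Pl Pd] := DP.
have mrA N : measurable_fun Om (fun x => r N x * \1_A x).
  by apply: (measurable_funM (mr N)); exact: measurable_indic.
have rA N x : Om x -> `|r N x * \1_A x| <= rho x.
  move=> Ox; rewrite normrM (ger0_norm (r0 _ _)) indicE ger0_norm//.
  by apply: le_trans (rle N x Ox); rewrite ler_piMr// lern1 leq_b1.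
have PD k : P \1_(D k `&` A).
  apply: (dominated_closed_sub_box DP (a := (F k).1) (b := (F k).2)).
  - by rewrite -boxE.
  - exact: measurableI.
  - by move=> x [/DQ].
have wD k : weight_integrable \1_(D k `&` A).
  apply: (weight_integrable_indic (@compact_box _ _ (F k))) => //.
    exact: measurableI.
  by move=> x [/DK].
(* [A] may be unbounded or leave [Om], but a partial sum only involves its traces on finitely many
   [D k], each inside a box; domination by [rho] reaches the whole sum. *)
apply: (Pd (fun N x => r N x * \1_A x) _ rho wrho mrA).
- by apply: (measurable_funM mrho); exact: measurable_indic.
- exact: rA.
- apply: aeW => x Ox; apply: cvgM; [exact: r_rho|exact: cvg_cst].
- elim=> [|N IH].
    rewrite (_ : (fun x => _) = (fun x => 0 * \1_(D 0%N `&` A) x + 0 * \1_(D 0%N `&` A) x)).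
      exact: Pl.
    by apply/funext => x; rewrite /r big_ord0 !mul0r addr0.
  rewrite (_ : (fun x => _) =
      (fun x => 1 * (r N x * \1_A x) + c N * \1_(D N `&` A) x)).
    by apply: Pl => //; exact: weight_integrable_le (mrA N) wrho (rA N).
  apply/funext => x; rewrite /r big_ord_recr/= mulrDl mul1r; congr (_ + _).
  by rewrite indicI/= mulrA.
Qed.

End density.

(** * Weak partial derivatives and functionals *)

Section banach_function_space_theory.
Context {R : realType} {n : nat}.
Local Notation T := 'rV[R]_n.+1.
Local Notation leb := (@lebesgue_rV R n).
Context (Om : set T) (X : banach_function_space Om).

Lemma bfs_norm_zero : bfs_norm X (fun=> 0) = 0.
Proof.
by have := bfs_normZ (b := X) 0 (bfs_zero X); rewrite normr0 !mul0r.
Qed.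

Lemma bfs_norm_ge0 (f : T -> R) : bfs_set X f -> 0 <= bfs_norm X f.
Proof.
move=> Xf; have := bfs_normD Xf (bfs_scale (-1) Xf).
rewrite bfs_normZ// normrN1 mul1r.
rewrite (_ : (fun x => _) = (fun=> 0)); last by apply/funext => x; rewrite mulN1r subrr.
by rewrite bfs_norm_zero; lra.
Qed.

(** (P4) on [K] bounds the integral by a multiple of the norm of [g] times [\1_K], which is finite
    by (P1). *)
Lemma bfs_compact_integral (g : T -> R) (K : set T) : bfs_set X g ->
  (\forall x \ae leb, Om x -> 0 <= g x) -> compact K -> K `<=` Om ->
  (\int[leb]_(x in K) `|g x|%:E < +oo)%E.
Proof.
move=> Xg g0 cK KOm; have [mK Kfin] := compact_lebesgue_lty cK.
have [C C0 HC] := @bfs_P4 R n Om X K mK KOm Kfin.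
apply: le_lt_trans (HC _ Xg) _.
have [XgK _] : bfs_set X (fun x => g x * \1_K x) /\
    bfs_norm X (fun x => g x * \1_K x) <= bfs_norm X g.
  apply: (bfs_P1 _ Xg _).
    by apply: measurable_funM; [exact: bfs_measurable Xg|exact: measurable_indic].
  apply: filterS g0 => x g0 /g0 gx; rewrite normrM ger0_norm//.
  by rewrite indicE ger0_norm// ler_piMr// lern1 leq_b1.
by rewrite /extended_norm asboolT//= -EFinM ltry.
Qed.

End banach_function_space_theory.

Section weak_partials.
Context {R : realType} {n : nat}.
Local Notation T := 'rV[R]_n.+1.
Local Notation leb := (@lebesgue_rV R n).
Context (Om : set T) (oOm : open Om).
Implicit Types (V : completeNormedModType R).

Let mOm : measurable Om. Proof. exact: open_measurable_rV. Qed.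
Let lebC : measure_is_complete leb. Proof. exact: lebesgue_rV_complete. Qed.

Lemma in_XV_L1_loc (X : banach_function_space Om) V (u : T -> V) :
  in_XV X u -> L1_loc Om u.
Proof.
move=> [su Xu]; split=> // K cK KOm.
have := bfs_compact_integral Xu (aeW _ (fun x _ => normr_ge0 (u x))) cK KOm.
by under eq_integral do rewrite normr_id.
Qed.

Lemma L1_loc_scale V (u : T -> V) (psi : T -> R) (K : set T) :
  L1_loc Om u -> continuous psi -> compact K -> K `<=` Om ->
  (forall x, ~ K x -> psi x = 0) -> L1 leb Om (fun x => psi x *: u x).
Proof.
move=> [su uK] cpsi cK KOm psi0; have [mK _] := compact_lebesgue_lty cK.
have mpsi : measurable_fun Om psi by exact: continuous_measurable_rV.
have spu : strongly_measurable leb Om (fun x => psi x *: u x).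
  exact: strongly_measurableZ.
have mnu : measurable_fun Om (fun x => `|u x|).
  exact: (strongly_measurable_norm lebC mOm su).
split=> //; have [C C0 HC] := compact_support_bounded cpsi cK psi0.
apply: (@le_lt_trans _ _ (C%:E * \int[leb]_(x in K) `|u x|%:E)%E); last first.
  by rewrite lte_mul_pinfty ?lee_fin//; exact: uK.
have mnuK : measurable_fun K (fun x => `|u x|%:E).
  by apply/measurable_EFinP; exact: (measurable_funS mOm KOm mnu).
have nu0 x : K x -> (0 <= `|u x|%:E)%E by rewrite lee_fin.
rewrite -(ge0_integralZl_EFin leb mK nu0 mnuK C0).
rewrite -[in leRHS](setIidr KOm) integral_mkcondr.
apply: (ge0_le_integral leb mOm).
- by move=> x _; rewrite lee_fin.
- by apply/measurable_EFinP; exact: (strongly_measurable_norm lebC mOm spu).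
- apply/(measurable_restrict _ mK mOm); rewrite (setIidr KOm).
  by apply: emeasurable_funM mnuK; exact: measurable_cst.
- move=> x Ox; rewrite /patch normrZ; case: ifPn => [_|xK].
    by rewrite -EFinM lee_fin ler_wpM2r.
  by rewrite psi0 ?normr0 ?mul0r//; move: xK; rewrite notin_setE.
Qed.

Lemma L1_test V (u : T -> V) (phi : T -> R^o) : L1_loc Om u ->
  test_function Om phi -> L1 leb Om (fun x => phi x *: u x) /\
  forall j, L1 leb Om (fun x => partial j phi x *: u x).
Proof.
move=> lu /test_function_cont_supp[cK KOm [cphi phi0] Hp]; split.
  exact: L1_loc_scale lu cphi cK KOm phi0.
by move=> j; have [cp p0] := Hp j; exact: L1_loc_scale lu cp cK KOm p0.
Qed.

Lemma L1_loc_dual V (u : T -> V) (f : {linear V -> R^o}) : dual_unit_ball f ->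
  L1_loc Om u -> L1_loc Om (f \o u).
Proof.
move=> fb [su uK]; have [cf _] := fb; have /dual_unit_ballP fle := fb.
have sfu := strongly_measurable_comp cf su.
split=> // K cK KOm; apply: le_lt_trans (uK K cK KOm).
have [mK _] := compact_lebesgue_lty cK.
apply: (ge0_le_integral leb mK).
- by move=> x _; rewrite lee_fin.
- apply/measurable_EFinP; apply: (measurable_funS mOm KOm).
  exact: (strongly_measurable_norm lebC mOm sfu).
- apply/measurable_EFinP; apply: (measurable_funS mOm KOm).
  exact: (strongly_measurable_norm lebC mOm su).
- by move=> x Kx; rewrite lee_fin fle.
Qed.

Lemma bochner_test_dual V (u : T -> V) (f : {linear V -> R^o}) (psi : T -> R) :
  dual_unit_ball f -> L1 leb Om (fun x => psi x *: u x) ->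
  leb.-integrable Om (fun x => (psi x * f (u x))%:E) /\
  f (bochner_integral leb Om (fun x => psi x *: u x)) =
  \int[leb]_(x in Om) (psi x * f (u x)).
Proof.
move=> fb L1u; have [iu ->] := bochner_integral_dual mOm lebC fb L1u.
have E x : f (psi x *: u x) = psi x * f (u x) by rewrite linearZ.
split; last by apply: eq_Rintegral => x _; rewrite E.
by apply: (eq_integrable mOm _ _ _ iu) => x _; rewrite /= E.
Qed.

Lemma is_weak_partial_real j (h w : T -> R^o) : is_weak_partial Om j h w ->
  forall phi, test_function Om phi ->
    \int[leb]_(x in Om) (partial j phi x * h x) =
    - \int[leb]_(x in Om) (phi x * w x).
Proof.
move=> [lh lw H] phi tphi; have := H _ tphi.
have [L1w _] := L1_test lw tphi; have [_ /(_ j) L1h] := L1_test lh tphi.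
by have [_ ->] := bochner_integral_real mOm lebC L1h;
  have [_ ->] := bochner_integral_real mOm lebC L1w.
Qed.

(** Functionals commute with the Bochner integral and separate points, so integration by parts in
    [V] can be tested on real integrals. *)
Lemma is_weak_partialP V j (u w : T -> V) :
  is_weak_partial Om j u w <->
  [/\ L1_loc Om u, L1_loc Om w & forall f : {linear V -> R^o}, dual_unit_ball f ->
    forall phi, test_function Om phi ->
    \int[leb]_(x in Om) (partial j phi x * f (u x)) =
    - \int[leb]_(x in Om) (phi x * f (w x))].
Proof.
split=> [[lu lw H]|[lu lw H]]; split=> //.
  move=> f fb phi tphi; have := congr1 f (H _ tphi).
  have [L1w _] := L1_test lw tphi; have [_ /(_ j) L1u] := L1_test lu tphi.
  rewrite linearN; have [_ ->] := bochner_test_dual fb L1w.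
  by have [_ ->] := bochner_test_dual fb L1u.
move=> phi tphi; apply: eq_dual => f fb.
have [L1w _] := L1_test lw tphi; have [_ /(_ j) L1u] := L1_test lu tphi.
rewrite linearN; have [_ ->] := bochner_test_dual fb L1w.
by have [_ ->] := bochner_test_dual fb L1u; exact: H.
Qed.

Lemma is_weak_partial_dual V j (u w : T -> V) (f : {linear V -> R^o}) :
  dual_unit_ball f -> is_weak_partial Om j u w ->
  is_weak_partial Om j (f \o u) (f \o w).
Proof.
move=> fb /is_weak_partialP[lu lw H].
have lfu := L1_loc_dual fb lu; have lfw := L1_loc_dual fb lw.
split=> // phi tphi.
have [L1w _] := L1_test lfw tphi; have [_ /(_ j) L1u] := L1_test lfu tphi.
have [_ ->] := bochner_integral_real mOm lebC L1u.
by have [_ ->] := bochner_integral_real mOm lebC L1w; exact: H.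
Qed.

(** Having zero integral against [w] is a property stable under limits dominated with respect to the
    absolute value of [w]. It therefore extends from test functions to [rho * \1_A] for all
    measurable [A], so [rho * w] vanishes almost everywhere, and [rho] is positive. *)
Lemma fundamental_lemma (w : T -> R^o) : L1_loc Om w ->
  (forall phi, test_function Om phi -> \int[leb]_(x in Om) (phi x * w x) = 0) ->
  \forall x \ae leb, Om x -> w x = 0.
Proof.
move=> [sw wK] H.
have mw : measurable_fun Om w.
  apply: (@strongly_measurable_measurable _ _ _ leb lebC R^o Om w id mOm _ sw).
  by move=> x; exact: cvg_id.
have mnw : measurable_fun Om (fun x => `|w x|) by exact: measurableT_comp.
have [rho [rho0 [mrho irho] Hrho]] :=
  exists_density_weight oOm mnw (fun x _ => normr_ge0 (w x)) wK.
have wi h : weight_integrable Om (fun x => `|w x|) h ->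
    leb.-integrable Om (fun x => (h x * w x)%:E).
  move=> [mh ih]; apply: (le_integrable mOm) ih.
    by apply/measurable_EFinP; exact: measurable_funM.
  by move=> x _; rewrite lee_fin !normrM normr_id.
pose P h := \int[leb]_(x in Om) (h x * w x) = 0.
have DP : dominated_closed Om (fun x => `|w x|) P.
  split; first exact: H.
    move=> a b h1 h2 wh1 wh2 Ph1 Ph2; rewrite /P.
    under eq_Rintegral do rewrite mulrDl -!mulrA.
    rewrite RintegralD//; [|exact: (integrableZl mOm a (wi _ wh1))|
      exact: (integrableZl mOm b (wi _ wh2))].
    rewrite !RintegralZl//; [|exact: wi|exact: wi].
    by move: Ph1 Ph2; rewrite /P => -> ->; rewrite !mulr0 addr0.
  move=> h_ h Hh wH mh_ mh hH hcvg Ph.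
  have : (fun k => \int[leb]_(x in Om) (h_ k x * w x)) @ \oo -->
      \int[leb]_(x in Om) (h x * w x).
    apply: (@Rintegral_dominated_cvg _ _ _ leb Om mOm _ _ (fun x => Hh x * `|w x|)).
    - by move=> k; exact: measurable_funM.
    - exact: measurable_funM.
    - by case: wH.
    - by apply: aeW => x k Ox; rewrite normrM ler_wpM2r// hH.
    - by apply: filterS hcvg => x hx Ox; apply: cvgM; [exact: hx|exact: cvg_cst].
  rewrite (_ : (fun k => _) = (fun=> 0)); last by apply/funext => k; exact: Ph.
  by move=> H0; rewrite /P -(cvg_lim _ H0)// lim_cst.
have irw : leb.-integrable Om (EFin \o (fun x => rho x * w x)) by exact: wi.
have : ae_eq leb Om (EFin \o (fun x => rho x * w x)) (cst 0%E).
  apply: integral_ae_eq => // E EOm mE.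
  have := Hrho P DP E mE; rewrite /P.
  under eq_Rintegral => x _ do rewrite mulrAC.
  rewrite Rintegral_indic// integral0 => H0.
  have irE := integrableS mOm mE EOm irw.
  by rewrite -[LHS](fineK (integrable_fin_num mE irE)); congr (_%:E).
apply: filterS => x rw Ox; have := rw Ox => /= -[] /eqP.
by rewrite mulf_eq0 gt_eqF ?rho0//= => /eqP.
Qed.

Lemma L1_locB V (u v : T -> V) : L1_loc Om u -> L1_loc Om v ->
  L1_loc Om (fun x => u x - v x).
Proof.
move=> [su uK] [sv vK]; have suv := strongly_measurableB su sv.
split=> // K cK KOm; have [mK _] := compact_lebesgue_lty cK.
have mn (z : T -> V) : strongly_measurable leb Om z ->
    measurable_fun K (fun x => `|z x|%:E).
  move=> sz; apply/measurable_EFinP; apply: (measurable_funS mOm KOm).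
  exact: (strongly_measurable_norm lebC mOm sz).
apply: (@le_lt_trans _ _ (\int[leb]_(x in K) (`|u x|%:E + `|v x|%:E))%E).
  apply: (ge0_le_integral leb mK).
  - by move=> x _; rewrite lee_fin.
  - exact: mn suv.
  - by apply: emeasurable_funD; [exact: mn su|exact: mn sv].
  - by move=> x _; rewrite -EFinD lee_fin ler_normB.
rewrite (ge0_integralD leb mK); last 4 first.
- by move=> x _; rewrite lee_fin.
- exact: mn su.
- by move=> x _; rewrite lee_fin.
- exact: mn sv.
by rewrite lte_add_pinfty//; [exact: uK|exact: vK].
Qed.

Lemma weak_partial_unique j (h w1 w2 : T -> R^o) :
  is_weak_partial Om j h w1 -> is_weak_partial Om j h w2 ->
  \forall x \ae leb, Om x -> w1 x = w2 x.
Proof.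
move=> hw1 hw2; have [lh lw1 _] := hw1; have [_ lw2 _] := hw2.
have : \forall x \ae leb, Om x -> (w1 x - w2 x : R^o) = 0.
  apply: fundamental_lemma; first exact: L1_locB.
  move=> phi tphi; under eq_Rintegral do rewrite mulrBr.
  have [L1w1 _] := L1_test lw1 tphi; have [L1w2 _] := L1_test lw2 tphi.
  have [i1 _] := bochner_integral_real mOm lebC L1w1.
  have [i2 _] := bochner_integral_real mOm lebC L1w2.
  rewrite RintegralB//; apply/eqP; rewrite -oppr_eq0 opprB subr_eq0; apply/eqP.
  apply: oppr_inj.
  by rewrite -(is_weak_partial_real hw1 tphi) -(is_weak_partial_real hw2 tphi).
by apply: filterS => x H /H /eqP; rewrite subr_eq0 => /eqP.
Qed.

End weak_partials.

(** * Densities under the Radon-Nikodym property *)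

Section dual_density.
Context {R : realType} {n : nat}.
Local Notation T := 'rV[R]_n.+1.
Local Notation leb := (@lebesgue_rV R n).
Context (Om : set T) (oOm : open Om) (V : completeNormedModType R).
(* [W f] plays the role of the composition of [f] with a density, not yet known
   to exist, that takes values in [V]. *)
Context (W : {linear V -> R^o} -> T -> R) (G : T -> R).
Context (mW : forall f, dual_unit_ball f -> measurable_fun Om (W f)).
Context (mG : measurable_fun Om G) (G0 : forall x, 0 <= G x).
Context (WG : forall f, dual_unit_ball f ->
  \forall x \ae leb, Om x -> `|W f x| <= G x).
Implicit Types (h : T -> R) (f : {linear V -> R^o}).

Let mOm : measurable Om. Proof. exact: open_measurable_rV. Qed.

Local Notation wint := (weight_integrable Om G).

Definition weight_norm h := \int[leb]_(x in Om) (`|h x| * G x).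

Lemma weight_integrable_norm h : wint h -> leb.-integrable Om (fun x => (`|h x| * G x)%:E).
Proof.
move=> [mh ih]; apply: (le_integrable mOm) ih.
  apply/measurable_EFinP; apply: (measurable_funM _ mG).
  by apply: (measurableT_comp _ mh); exact: normr_measurable.
by move=> x _; rewrite lee_fin !normrM normr_id.
Qed.

Lemma weight_integrable_dual h f : dual_unit_ball f -> wint h ->
  leb.-integrable Om (fun x => (h x * W f x)%:E).
Proof.
move=> fb [mh ih]; apply: (ae_le_integrable mOm _ ih).
  exact: measurable_funM mh (mW fb).
apply: filterS (WG fb) => x H Ox; rewrite !normrM ler_wpM2l//.
by rewrite (ger0_norm (G0 x)) H.
Qed.

(** [e] is the Pettis integral of [h] times the density sought, written without that density. *)
Definition dual_mean h (e : V) := forall f, dual_unit_ball f ->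
  f e = \int[leb]_(x in Om) (h x * W f x).

(** The majorant [G] is the same for all functionals, so the estimate survives the choice of a
    functional norming [e]. *)
Lemma dual_mean_norm h e : wint h -> dual_mean h e -> `|e| <= weight_norm h.
Proof.
move=> wh he; apply: le_dual => f fb; rewrite he//.
apply: le_trans (ler_norm _) _.
apply: le_trans (le_normr_Rintegral mOm (weight_integrable_dual fb wh)) _.
have ihW := weight_integrable_dual fb wh; have ihn := weight_integrable_norm wh.
rewrite -lee_fin !fineK; last 2 first.
- exact: integrable_fin_num ihn.
- apply: integrable_fin_num => //; exact: integrable_norm ihW.
apply: (ae_ge0_le_integral mOm).
- by move=> x _; rewrite lee_fin.
- by apply: measurable_int; exact: integrable_norm ihW.
- by move=> x _; rewrite lee_fin mulr_ge0.
- exact: measurable_int ihn.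
- apply: filterS (WG fb) => x H Ox; rewrite lee_fin normrM ler_wpM2l//.
  exact: H.
Qed.

Lemma dual_mean_lin (a b : R) h1 h2 e1 e2 : wint h1 -> wint h2 ->
  dual_mean h1 e1 -> dual_mean h2 e2 ->
  dual_mean (fun x => a * h1 x + b * h2 x) (a *: e1 + b *: e2).
Proof.
move=> w1 w2 H1 H2 f fb.
have i1 := weight_integrable_dual fb w1; have i2 := weight_integrable_dual fb w2.
rewrite linearD !linearZ/= H1// H2//.
have -> : \int[leb]_(x in Om) ((a * h1 x + b * h2 x) * W f x) =
    \int[leb]_(x in Om) (a * (h1 x * W f x) + b * (h2 x * W f x)).
  by apply: eq_Rintegral => x _; rewrite mulrDl -!mulrA.
rewrite (RintegralD mOm (integrableZl mOm a i1) (integrableZl mOm b i2)).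
by rewrite (RintegralZl _ mOm i1) (RintegralZl _ mOm i2).
Qed.

Lemma weight_norm_cvg (h_ : nat -> T -> R) H : wint H ->
  (forall k, measurable_fun Om (h_ k)) ->
  (\forall x \ae leb, forall k, Om x -> `|h_ k x| <= H x) ->
  (\forall x \ae leb, Om x -> h_ k x @[k --> \oo] --> (0 : R)) ->
  weight_norm (h_ k) @[k --> \oo] --> (0 : R).
Proof.
move=> [mH iH] mh hH hcvg.
have -> : (0 : R) = \int[leb]_(x in Om) 0 by rewrite /Rintegral integral0.
apply: (@Rintegral_dominated_cvg _ _ _ leb Om mOm _ _ (fun x => H x * G x)).
- move=> k; apply: (measurable_funM _ mG).
  by apply: (measurableT_comp _ (mh k)); exact: normr_measurable.
- exact: measurable_cst.
- exact: iH.
- apply: filterS hH => x hH k Ox; rewrite normrM normr_id (ger0_norm (G0 x)).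
  by rewrite ler_wpM2r// hH.
- apply: filterS hcvg => x hx Ox; rewrite -(mul0r (G x)) -(@normr0 _ R).
  by apply: cvgM; [apply: cvg_norm; exact: hx|exact: cvg_cst].
Qed.

Lemma weight_norm_distD h1 h2 h : wint h1 -> wint h2 -> wint h ->
  weight_norm (fun x => 1 * h1 x + (-1) * h2 x) <=
  weight_norm (fun x => 1 * h1 x + (-1) * h x) +
  weight_norm (fun x => 1 * h2 x + (-1) * h x).
Proof.
move=> w1 w2 w.
have i1 := weight_integrable_norm (weight_integrable_lin oOm 1 (-1) w1 w).
have i2 := weight_integrable_norm (weight_integrable_lin oOm 1 (-1) w2 w).
have i12 := weight_integrable_norm (weight_integrable_lin oOm 1 (-1) w1 w2).
rewrite /weight_norm -(RintegralD mOm i1 i2).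
apply: (le_Rintegral mOm i12); first exact: integrableD i1 i2.
move=> x _; rewrite -mulrDl ler_wpM2r// !mul1r !mulN1r.
rewrite [`|h2 x - h x|]distrC; apply: le_trans (ler_normD _ _).
by rewrite addrA subrK.
Qed.

(** By [dual_mean_norm], vectors representing a dominated convergent sequence form a Cauchy
    sequence; their limit represents the limit function, as each functional shows by dominated
    convergence. *)
Lemma dominated_closed_dual_mean :
  (forall phi, test_function Om phi -> exists e, dual_mean phi e) ->
  dominated_closed Om G (fun h => exists e, dual_mean h e).
Proof.
move=> Ht; split=> //.
  move=> a b h1 h2 w1 w2 [e1 H1] [e2 H2]; exists (a *: e1 + b *: e2).
  exact: dual_mean_lin.
move=> h_ h H wH mh_ mh hH hcvg /choice[e he].
have wk k : wint (h_ k) by exact: (weight_integrable_le oOm mG (mh_ k) wH (hH k)).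
have wh : wint h.
  split=> //; apply: (ae_le_integrable mOm _ wH.2).
    exact: measurable_funM mh mG.
  apply: filterS hcvg => x hx Ox; rewrite !normrM ler_wpM2r//.
  rewrite (ger0_norm (le_trans (normr_ge0 _) (hH 0%N x Ox))).
  by apply: cvg_norm_le (hx Ox) _ => k; exact: hH.
pose a k := weight_norm (fun x => 1 * h_ k x + (-1) * h x).
have ecauchy : cvg (e k @[k --> \oo]).
  apply: (@cauchy_bound_cvg _ _ _ a) => [k l|].
    have := dual_mean_lin 1 (-1) (wk k) (wk l) (he k) (he l).
    move=> /(dual_mean_norm (weight_integrable_lin oOm 1 (-1) (wk k) (wk l))).
    rewrite scale1r scaleN1r => /le_trans; apply.
    exact: weight_norm_distD.
  (* The majorant is [2 * H]; the null summand gives it the shape of [weight_integrable_lin]. *)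
  apply: (@weight_norm_cvg _ (fun x => 2 * H x + 0 * H x)).
  - exact: weight_integrable_lin.
  - move=> k; exact: (weight_integrable_lin oOm 1 (-1) (wk k) wh).1.
  - apply: filterS hcvg => x hx k Ox; rewrite mul1r mulN1r mul0r addr0.
    apply: le_trans (ler_normB _ _) _; rewrite mulr_natl mulr2n lerD ?hH//.
    by apply: cvg_norm_le (hx Ox) _ => l; exact: hH.
  - apply: filterS hcvg => x hx Ox; rewrite -(subrr (h x)).
    under eq_fun do rewrite mul1r mulN1r.
    by apply: cvgB; [exact: hx|exact: cvg_cst].
have /cvg_ex[e0 ee0] := ecauchy; exists e0 => f fb; have [cf _] := fb.
have H1 : f (e k) @[k --> \oo] --> f e0.
  by apply: (@cvg_comp _ _ _ _ f _ _ _ ee0); exact: cf.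
have H2 : f (e k) @[k --> \oo] --> (\int[leb]_(x in Om) (h x * W f x) : R^o).
  rewrite (_ : (fun k => _) = (fun k => \int[leb]_(x in Om) (h_ k x * W f x))); last first.
    by apply/funext => k; exact: he.
  apply: (@Rintegral_dominated_cvg _ _ _ leb Om mOm _ _ (fun x => H x * G x)).
  - by move=> k; exact: measurable_funM (mh_ k) (mW fb).
  - exact: measurable_funM mh (mW fb).
  - by case: wH.
  - apply: filterS (WG fb) => x Wx k Ox; rewrite normrM.
    by rewrite ler_pM// ?hH//; exact: Wx.
  - by apply: filterS hcvg => x hx Ox; apply: cvgM; [exact: hx|exact: cvg_cst].
exact: (cvg_unique _ H1 H2).
Qed.

End dual_density.

Section exists_dual_density.
Context {R : realType} {n : nat}.
Local Notation T := 'rV[R]_n.+1.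
Local Notation leb := (@lebesgue_rV R n).
Context (Om : set T) (oOm : open Om) (V : completeNormedModType R).
Context (W : {linear V -> R^o} -> T -> R) (G : T -> R).
Context (mW : forall f, dual_unit_ball f -> measurable_fun Om (W f)).
Context (mG : measurable_fun Om G) (G0 : forall x, 0 <= G x).
Context (WG : forall f, dual_unit_ball f ->
  \forall x \ae leb, Om x -> `|W f x| <= G x).
Implicit Types (h : T -> R) (f : {linear V -> R^o}).

Let mOm : measurable Om. Proof. exact: open_measurable_rV. Qed.
Let lebC : measure_is_complete leb. Proof. exact: lebesgue_rV_complete. Qed.

(** Integrals in [dual_mean] run over [Om] only, so [nu] is defined on the measurable subsets of the
    whole space and the Radon-Nikodym property applies to [leb] itself. The weight [rho] built into
    [nu] is divided out at the end, being positive on [Om]. *)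
Lemma exists_dual_density : radon_nikodym_property V ->
  (forall K, compact K -> K `<=` Om -> (\int[leb]_(x in K) (G x)%:E < +oo)%E) ->
  (forall phi, test_function Om phi -> exists e, dual_mean Om W phi e) ->
  exists2 w : T -> V, strongly_measurable leb Om w &
    forall f, dual_unit_ball f -> \forall x \ae leb, Om x -> f (w x) = W f x.
Proof.
move=> rnp GK Ht.
have [rho [rho0 wrho Hrho]] := exists_density_weight oOm mG (fun x _ => G0 x) GK.
have DP := dominated_closed_dual_mean oOm mW mG G0 WG Ht.
have mrho := wrho.1.
pose h A x : R := rho x * \1_A x.
have /choice[nu nuP] (A : set T) : exists e, measurable A -> dual_mean Om W (h A) e.
  have [mA|nA] := pselect (measurable A); last by exists 0.
  by have [e He] := Hrho _ DP A mA; exists e.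
have mh A : measurable A -> measurable_fun Om (h A).
  by move=> mA; apply: measurable_funM mrho _; exact: measurable_indic.
have hrho A x : Om x -> `|h A x| <= rho x.
  move=> Ox; rewrite /h normrM gtr0_norm ?rho0// indicE ger0_norm//.
  by rewrite ler_piMr ?(ltW (rho0 _ _))// lern1 leq_b1.
have wh A : measurable A -> weight_integrable Om G (h A).
  by move=> mA; exact: (weight_integrable_le oOm mG (mh A mA) wrho (hrho A)).
have nu_norm A : measurable A -> `|nu A| <= weight_norm Om G (h A).
  by move=> mA; exact: (dual_mean_norm oOm mW mG G0 WG (wh A mA) (nuP A mA)).
have nuM : is_vector_measure nu.
  move=> F mF tF; set U := \bigcup_i F i.
  have mU : measurable U by exact: bigcupT_measurable.
  pose B k := U `\` \big[setU/set0]_(i < k) F i.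
  have mB k : measurable (B k).
    by apply: measurableD => //; exact: bigsetU_measurable.
  have FB k : F k `<=` B k.
    move=> x Fkx; split; first by exists k.
    rewrite -bigcup_mkord => -[i /= ik Fix].
    have ik' := tF i k I I (ex_intro _ x (conj Fix Fkx)).
    by rewrite ik' ltnn in ik.
  (* The remainder of the series is the mean over the tail [B k]; its norm is at most the weighted
     norm of [h (B k)], which tends to 0 because the tails decrease to the empty set. *)
  have BE k : dual_mean Om W (h (B k)) (nu U - \sum_(i < k) nu (F i)).
    elim: k => [|k IH].
      by rewrite /B !big_ord0 setD0 subr0; exact: nuP.
    have := dual_mean_lin oOm mW G0 WG 1 (-1) (wh _ (mB k)) (wh _ (mF k))
      IH (nuP _ (mF k)).
    rewrite scale1r scaleN1r big_ord_recr/= opprD addrA; congr dual_mean.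
    apply/funext => x; rewrite mul1r mulN1r /h -mulrBr; congr (_ * _).
    have -> : B k.+1 = B k `\` F k by rewrite /B big_ord_recr/= setDDl.
    by symmetry; apply: indic_setD; exact: FB.
  have lim0 : weight_norm Om G (h (B k)) @[k --> \oo] --> (0 : R).
    apply: (weight_norm_cvg oOm mG G0 wrho).
    - by move=> k; exact: mh.
    - by apply: aeW => x k Ox; exact: hrho.
    - apply: aeW => x Ox; have [[m _ Fmx]|nUx] := pselect (U x).
        apply: cvg_near_cst; exists m.+1 => // k /= mk.
        rewrite /h indicE memNset ?mulr0// => -[_]; apply.
        by rewrite -bigcup_mkord; exists m.
      by apply: cvg_near_cst; apply: nearW => k; rewrite /h indicE memNset ?mulr0// => -[].
  apply/cvgrPdist_le => e e0; have /cvgrPdist_le/(_ e e0) := lim0.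
  apply: filterS => k; rewrite sub0r normrN => /(le_trans (ler_norm _)).
  apply: le_trans.
  exact: (dual_mean_norm oOm mW mG G0 WG (wh _ (mB k)) (BE k)).
have nuV : (vector_total_variation nu < +oo)%E.
  apply: (@le_lt_trans _ _ (\int[leb]_(x in Om) (rho x * G x)%:E)%E); last first.
    exact: integrable_lty wrho.2.
  apply: ge_ereal_sup => _ [[k F] /= [mF tF _] <-].
  apply: (@le_trans _ _ (\sum_(i < k) \int[leb]_(x in Om) (`|h (F i) x| * G x)%:E)%E).
    rewrite -sumEFin; apply: lee_sum => i _.
    rewrite -(fineK (integrable_fin_num mOm (weight_integrable_norm oOm mG (wh _ (mF i))))).
    by rewrite lee_fin; exact: nu_norm.
  have mhG i : measurable_fun Om (fun x => (`|h (F i) x| * G x)%:E).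
    exact: measurable_int (weight_integrable_norm oOm mG (wh _ (mF i))).
  rewrite -(ge0_integral_sum leb mOm
    (f := fun (i : 'I_k) x => (`|h (F i) x| * G x)%:E)); last 2 first.
    by move=> i; exact: mhG.
    by move=> i x _; rewrite lee_fin mulr_ge0.
  apply: (ge0_le_integral leb mOm).
  - by move=> x _; apply: sume_ge0 => i _; rewrite lee_fin mulr_ge0.
  - exact: emeasurable_sum.
  - exact: measurable_int wrho.2.
  (* The pieces are disjoint, so their indicators add up to at most 1 and the variation is at most
     the integral of [rho * G]. *)
  - move=> x Ox; rewrite sumEFin lee_fin -mulr_suml ler_wpM2r//.
    under eq_bigr => i _.
      rewrite /h normrM (gtr0_norm (rho0 _ Ox)) (@ger0_norm _ (\1_(F i) x)); last by rewrite indicE.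
      over.
    by rewrite -mulr_sumr ler_piMr ?(ltW (rho0 _ Ox))//; exact: sum_indic_le1.
have nuA : vector_abs_continuous nu leb.
  move=> A mA A0; apply/eqP; rewrite -normr_le0; apply: le_trans (nu_norm A mA) _.
  rewrite /weight_norm /Rintegral (_ : (\int[_]_(x in _) _ = 0)%E)//.
  rewrite -(integral0 leb Om); apply: ae_eq_integral.
  - exact: mOm.
  - exact: measurable_int (weight_integrable_norm oOm mG (wh _ mA)).
  - exact: measurable_cst.
  - exists A; split=> // x /not_implyP[_ H]; apply: contrapT => nAx; apply: H.
    by rewrite /h indicE memNset//= mulr0 normr0 mul0r.
have [F [[sF Fint] FnuE]] := rnp _ _ leb nu lebC nuM nuV nuA.
have sFO : strongly_measurable leb Om F by exact: strongly_measurableS sF.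
have mV := measurable_funV mrho rho0.
exists (fun x => (rho x)^-1 *: F x).
  exact: strongly_measurableZ.
move=> f fb.
have L1F E : measurable E -> L1 leb E F.
  move=> mE; have sFE : strongly_measurable leb E F by exact: strongly_measurableS sF.
  split; first exact: sFE.
  apply: le_lt_trans Fint; apply: (ge0_subset_integral leb mE measurableT).
  - by apply/measurable_EFinP; exact: (strongly_measurable_norm lebC measurableT sF).
  - by move=> x _; rewrite lee_fin.
  - exact: subsetT.
have iW := weight_integrable_dual oOm mW G0 WG fb wrho.
(* Over every measurable [E] inside [Om] both sides integrate to [f (nu E)]: one because [F] is the
   density of [nu], the other by [dual_mean]. *)
have : ae_eq leb Om (EFin \o (f \o F)) (fun x => (rho x * W f x)%:E).
  have [ifF _] := bochner_integral_dual mOm lebC fb (L1F Om mOm).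
  apply: (integral_ae_eq mOm ifF); first exact: measurable_int iW.
  move=> E EOm mE.
  have [ifE fE] := bochner_integral_dual mE lebC fb (L1F E mE).
  have iWE := integrableS mOm mE EOm iW.
  have EQ : \int[leb]_(x in E) f (F x) = \int[leb]_(x in E) (rho x * W f x).
    rewrite -fE -FnuE// (nuP E mE f fb).
    rewrite -(Rintegral_indic leb (fun x => rho x * W f x) EOm).
    by apply: eq_Rintegral => x _; rewrite /h mulrAC.
  rewrite -[LHS](fineK (integrable_fin_num mE ifE)).
  rewrite -[RHS](fineK (integrable_fin_num mE iWE)); congr (_%:E).
  exact: EQ.
apply: filterS => x H Ox; have [fF] := H Ox.
by rewrite linearZ/= fF; apply: mulKf; rewrite gt_eqF// rho0.
Qed.

End exists_dual_density.

(** * Sobolev and Reshetnyak-Sobolev functions *)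

Section gradient_norm.
Context {R : realType}.

Definition euclid {m : nat} (a : 'I_m -> R) : R := Num.sqrt (\sum_(j < m) a j ^+ 2).

Lemma le_euclid m (a b : 'I_m -> R) : (forall j, `|a j| <= `|b j|) ->
  euclid a <= euclid b.
Proof.
move=> ab; rewrite ler_sqrt; last by apply: sumr_ge0 => j _; exact: sqr_ge0.
by apply: ler_sum => j _; rewrite -[leLHS]real_normK ?num_real//
  -[leRHS]real_normK ?num_real// lerXn2r ?nnegrE.
Qed.

Lemma euclid_coord m (a : 'I_m -> R) (j : 'I_m) : `|a j| <= euclid a.
Proof.
rewrite -sqrtr_sqr ler_sqrt; last by apply: sumr_ge0 => i _; exact: sqr_ge0.
by rewrite (bigD1 j)//= lerDl sumr_ge0// => i _; exact: sqr_ge0.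
Qed.

(** With this bound (P1) places the gradient norm in [X], which contains the finite sums of its
    elements. *)
Lemma euclid_le_sum m (a : 'I_m -> R) : (forall j, 0 <= a j) ->
  euclid a <= \sum_(j < m) a j.
Proof.
move=> a0; have s0 : 0 <= \sum_(j < m) a j by exact: sumr_ge0.
rewrite -[leRHS](ger0_norm s0) -sqrtr_sqr ler_sqrt ?sqr_ge0//.
rewrite [leRHS]expr2 mulr_suml; apply: ler_sum => j _; rewrite expr2 ler_wpM2l//.
by rewrite (bigD1 j)//= lerDl sumr_ge0.
Qed.

(** Origin of the constant [sqrt n] in the theorem, with [m] the dimension and [c] the value of an
    upper gradient. *)
Lemma euclid_le_const m (a : 'I_m -> R) (c : R) :
  (forall j, 0 <= a j <= c) -> 0 <= c -> euclid a <= Num.sqrt m%:R * c.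
Proof.
move=> ac c0; rewrite -[X in _ * X](ger0_norm c0) -sqrtr_sqr -sqrtrM//.
rewrite ler_sqrt; last by rewrite mulr_ge0// sqr_ge0.
rewrite mulr_natl -[X in _ *+ X](card_ord m) -sumr_const.
by apply: ler_sum => j _; have /andP[a0 ?] := ac j; rewrite lerXn2r ?nnegrE.
Qed.

End gradient_norm.

Section reshetnyak.
Context {R : realType} {n : nat}.
Local Notation T := 'rV[R]_n.+1.
Local Notation leb := (@lebesgue_rV R n).
Context (Om : set T) (X : banach_function_space Om) (oOm : open Om).
Context (V : completeNormedModType R).
Implicit Types (u : T -> V) (f : {linear V -> R^o}).

Let mOm : measurable Om. Proof. exact: open_measurable_rV. Qed.
Let lebC : measure_is_complete leb. Proof. exact: lebesgue_rV_complete. Qed.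

Lemma W1X_is_weak_partial (Z : completeNormedModType R) (u : T -> Z) j :
  W1X X u -> is_weak_partial Om j u (weak_partial Om j u).
Proof. by move=> [_ /(_ j)[ex _]]; exact: xgetPex. Qed.

Lemma in_XV_le (Y : completeNormedModType R) (v : T -> Y) (g : T -> R) :
  strongly_measurable leb Om v -> bfs_set X g ->
  (\forall x \ae leb, Om x -> `|v x| <= g x) -> in_XV X v.
Proof.
move=> sv Xg vg; split=> //; have mv := strongly_measurable_norm lebC mOm sv.
apply: (proj1 (bfs_P1 (b := X) mv Xg _)).
by apply: filterS vg => x H Ox; rewrite normr_id H.
Qed.

Lemma measurable_grad_norm (Y : completeNormedModType R) (v : T -> Y) :
  (forall j, strongly_measurable leb Om (weak_partial Om j v)) ->
  measurable_fun Om (grad_norm Om v).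
Proof.
move=> sv; have mS : measurable_fun Om
    (fun x => \sum_(j < n.+1) `|weak_partial Om j v x| ^+ 2).
  apply: measurable_sum => j; apply: measurable_funX.
  exact: (strongly_measurable_norm lebC mOm (sv j)).
by apply: (measurableT_comp _ mS); apply: continuous_measurable_fun; exact: sqrt_continuous.
Qed.

Lemma bfs_sum (I : Type) (r : seq I) (g : I -> T -> R) :
  (forall i, bfs_set X (g i)) -> bfs_set X (fun x => \sum_(i <- r) g i x).
Proof.
move=> Xg; elim: r => [|i r IH].
  by under eq_fun do rewrite big_nil; exact: bfs_zero.
by under eq_fun do rewrite big_cons; exact: bfs_add.
Qed.

Lemma bfs_grad_norm (Y : completeNormedModType R) (v : T -> Y) :
  (forall j, in_XV X (weak_partial Om j v)) -> bfs_set X (grad_norm Om v).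
Proof.
move=> Xv; have Xs := bfs_sum (index_enum 'I_n.+1) (fun j => (Xv j).2).
have mg : measurable_fun Om (grad_norm Om v).
  by apply: measurable_grad_norm => j; exact: (Xv j).1.
apply: (proj1 (bfs_P1 (b := X) mg Xs _)).
apply: aeW => x _; rewrite ger0_norm ?sqrtr_ge0//.
exact: (@euclid_le_sum _ _ (fun j => `|weak_partial Om j v x|)).
Qed.

(** [weak_partial] selects some representative, so the one selected for [f \o u] agrees with [f]
    applied to that of [u] only almost everywhere, by uniqueness; [f] then does not increase
    norms. *)
Lemma W1X_dual u f : W1X X u -> dual_unit_ball f ->
  W1X X (f \o u) /\
  (\forall x \ae leb, Om x -> grad_norm Om (f \o u) x <= grad_norm Om u x).
Proof.
move=> Wu fb; have [[su Xu] Hu] := Wu; have [cf _] := fb.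
have /dual_unit_ballP fle := fb.
have wp j := is_weak_partial_dual oOm fb (W1X_is_weak_partial j Wu).
have wp' j : is_weak_partial Om j (f \o u) (weak_partial Om j (f \o u)).
  by apply: xgetPex; exists (f \o weak_partial Om j u).
have le_wp j : \forall x \ae leb, Om x ->
    `|weak_partial Om j (f \o u) x| <= `|weak_partial Om j u x|.
  apply: filterS (weak_partial_unique oOm (wp' j) (wp j)) => x H Ox.
  by rewrite H//=; exact: fle.
split; last first.
  have : \forall x \ae leb, forall j, Om x ->
      `|weak_partial Om j (f \o u) x| <= `|weak_partial Om j u x|.
    by apply: filter_forall => j; exact: le_wp.
  apply: filterS => x H Ox.
  apply: (@le_euclid _ _ (fun j => `|weak_partial Om j (f \o u) x|)
    (fun j => `|weak_partial Om j u x|)) => j.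
  by rewrite !normr_id H.
split.
  apply: (in_XV_le (strongly_measurable_comp cf su) Xu).
  by apply: aeW => x _; exact: fle.
move=> j; split; first by exists (f \o weak_partial Om j u).
have [_ [sw _] _] := wp' j.
by apply: (in_XV_le sw (Hu j).2.2); exact: le_wp.
Qed.

Lemma inf_norm_le u g : reshetnyak_upper_gradient X u g ->
  inf (bfs_norm X @` reshetnyak_upper_gradient X u) <= bfs_norm X g.
Proof.
move=> ug; apply: ge_inf; last by exists g.
by exists 0 => _ [h [Xh _ _] <-]; exact: bfs_norm_ge0.
Qed.

Lemma W1X_R1X u : W1X X u ->
  [/\ R1X X u, reshetnyak_upper_gradient X u (grad_norm Om u) &
      R1X_norm X u <= W1X_norm X u].
Proof.
move=> Wu; have [Xu Hu] := Wu.
have ug : reshetnyak_upper_gradient X u (grad_norm Om u).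
  split.
  - by apply: bfs_grad_norm => j; have [] := Hu j.
  - by apply: aeW => x _; exact: sqrtr_ge0.
  - by move=> f fb; have [] := W1X_dual Wu fb.
split=> //; last by rewrite lerD2l; exact: inf_norm_le.
split=> //; last by exists (grad_norm Om u).
by move=> f fb; have [] := W1X_dual Wu fb.
Qed.

Lemma upper_gradient_dual u g f j : reshetnyak_upper_gradient X u g ->
  dual_unit_ball f ->
  \forall x \ae leb, Om x -> `|weak_partial Om j (f \o u) x| <= g x.
Proof.
move=> [_ _ /(_ f)] H /H; apply: filterS => x {}H /H; apply: le_trans.
have := @euclid_coord _ _ (fun j => `|weak_partial Om j (f \o u) x|) j.
by rewrite normr_id.
Qed.

(** For each [f], uniqueness identifies [f \o w] with the partial of [f \o u], which [g] bounds.
    Stated for every upper gradient, so that the norm estimate can pass to the infimum. *)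
Lemma upper_gradient_weak_partial u g j (w : T -> V) :
  R1X X u -> reshetnyak_upper_gradient X u g -> is_weak_partial Om j u w ->
  \forall x \ae leb, Om x -> `|w x| <= g x.
Proof.
move=> Ru ug uw; have [_ [sw _] _] := uw.
apply: (strongly_measurable_norming sw) => f fb; have [_ Wf _] := Ru.
have := weak_partial_unique oOm (is_weak_partial_dual oOm fb uw)
  (W1X_is_weak_partial j (Wf f fb)).
by apply: filterS2 (upper_gradient_dual j ug fb) => x H E Ox;
  move: (E Ox) => /= ->; exact: H.
Qed.

Lemma R1X_exists_weak_partial u j : radon_nikodym_property V -> R1X X u ->
  exists w, is_weak_partial Om j u w.
Proof.
move=> rnp Ru; have [Xu Wf [g ug]] := Ru; have [Xg g0 _] := ug.
have lu := in_XV_L1_loc Xu.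
pose W f := weak_partial Om j (f \o u) : T -> R.
have WP f : dual_unit_ball f -> is_weak_partial Om j (f \o u) (W f).
  by move=> fb; exact: W1X_is_weak_partial (Wf f fb).
have mW f : dual_unit_ball f -> measurable_fun Om (W f).
  move=> /WP[_ [sW _] _].
  apply: (@strongly_measurable_measurable _ _ _ leb lebC R^o Om (W f) id mOm _ sW).
  by move=> x; exact: cvg_id.
(* An upper gradient is non-negative only almost everywhere; its absolute value is a majorant that
   is non-negative everywhere. *)
have mG : measurable_fun Om (fun x => `|g x|).
  by apply: (measurableT_comp _ (bfs_measurable Xg)); exact: normr_measurable.
have WG f : dual_unit_ball f -> \forall x \ae leb, Om x -> `|W f x| <= `|g x|.
  move=> fb; apply: filterS (upper_gradient_dual j ug fb) => x H Ox.
  exact: le_trans (H Ox) (ler_norm _).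
have [w sw wE] : exists2 w : T -> V, strongly_measurable leb Om w &
    forall f, dual_unit_ball f -> \forall x \ae leb, Om x -> f (w x) = W f x.
  apply: (exists_dual_density oOm mW mG _ WG rnp) => //.
    by move=> K cK KOm; exact: bfs_compact_integral Xg g0 cK KOm.
  (* The vector representing a test function: under [f], integration by parts moves the derivative
     from [phi] to [f \o u] and yields [W f]. *)
  move=> phi tphi; exists (- bochner_integral leb Om (fun x => partial j phi x *: u x)).
  move=> f fb; have [_ /(_ j) L1u] := L1_test oOm lu tphi.
  rewrite linearN; have [_ ->] := bochner_test_dual oOm fb L1u.
  have := is_weak_partial_real oOm (WP f fb) tphi => /= ->.
  by rewrite opprK.
have Xw : in_XV X w.
  apply: (in_XV_le sw Xg); apply: (strongly_measurable_norming sw) => f fb.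
  apply: filterS2 (wE f fb) (upper_gradient_dual j ug fb) => x E H Ox.
  by rewrite E//; exact: H.
have lw := in_XV_L1_loc Xw.
exists w; apply/(is_weak_partialP oOm); split=> // f fb phi tphi.
have -> := is_weak_partial_real oOm (WP f fb) tphi; congr (- _).
have [sphi _ _] := tphi; have [cphi _] := sphi [::].
have mphi : measurable_fun Om phi by exact: continuous_measurable_rV.
have [cf _] := fb.
rewrite /Rintegral; congr fine; apply: ae_eq_integral; first exact: mOm.
- by apply/measurable_EFinP; exact: measurable_funM mphi (mW f fb).
- apply/measurable_EFinP; apply: (measurable_funM mphi).
  exact: (strongly_measurable_measurable lebC mOm cf sw).
- by apply: filterS (wE f fb) => x E Ox; rewrite E.
Qed.

Lemma R1X_W1X u : radon_nikodym_property V -> R1X X u ->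
  W1X X u /\ W1X_norm X u <= Num.sqrt n.+1%:R * R1X_norm X u.
Proof.
move=> rnp Ru; have [Xu _ [g0 ug0]] := Ru.
have wp j : is_weak_partial Om j u (weak_partial Om j u).
  by apply: xgetPex; exact: R1X_exists_weak_partial.
have Wu : W1X X u.
  split=> // j; split; first by exists (weak_partial Om j u).
  have [_ [sw _] _] := wp j; have [Xg _ _] := ug0.
  by apply: (in_XV_le sw Xg); exact: upper_gradient_weak_partial ug0 (wp j).
split=> //; have s1 : 1 <= Num.sqrt n.+1%:R :> R.
  by rewrite -[leLHS]sqrtr1 ler_sqrt// ler1n.
have s0 : 0 < Num.sqrt n.+1%:R :> R by exact: lt_le_trans s1.
have Xgrad : bfs_set X (grad_norm Om u) by apply: bfs_grad_norm => j; have [] := Wu.2 j.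
rewrite /W1X_norm /R1X_norm mulrDr lerD//.
  by rewrite ler_peMl//; exact: bfs_norm_ge0 Xu.2.
(* The infimum may not be attained, so the bound is proved for every upper gradient. *)
rewrite -ler_pdivrMl//; apply: lb_le_inf; first by exists (bfs_norm X g0), g0.
move=> _ [g ug <-]; have [Xg gge0 _] := ug; rewrite ler_pdivrMl//.
rewrite -[X in X * _](gtr0_norm s0) -bfs_normZ//.
have mgrad := bfs_measurable Xgrad.
apply: (proj2 (bfs_P1 (b := X) mgrad (bfs_scale (Num.sqrt n.+1%:R) Xg) _)).
have wg : \forall x \ae leb, forall j, Om x -> `|weak_partial Om j u x| <= g x.
  by apply: filter_forall => j; exact: upper_gradient_weak_partial ug (wp j).
apply: filterS2 wg gge0 => x H g_ge0 Ox; rewrite ger0_norm ?sqrtr_ge0//.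
apply: (@euclid_le_const _ _ (fun j => `|weak_partial Om j u x|)); last exact: g_ge0.
by move=> j; rewrite normr_ge0/= H.
Qed.

End reshetnyak.

Theorem theorem3p5 (R : realType) (n : nat) (Om : set 'rV[R]_n.+1)
    (X : banach_function_space Om) (V : completeNormedModType R)
    (oOm : open Om) :
  (forall u : 'rV[R]_n.+1 -> V, W1X X u ->
     [/\ R1X X u, reshetnyak_upper_gradient X u (grad_norm Om u) &
         R1X_norm X u <= W1X_norm X u]) /\
  (radon_nikodym_property V ->
   forall u : 'rV[R]_n.+1 -> V, R1X X u ->
     W1X X u /\ W1X_norm X u <= Num.sqrt n.+1%:R * R1X_norm X u).
Proof. by split=> [u|rnp u]; [exact: W1X_R1X|exact: R1X_W1X]. Qed.
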